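(* Let $d\ge2$ and let $K$ be a $d$-dimensional convex body. If $K$ is $o$-symmetric, then $$\mathrm{coin}_w(K)<2^d\sqrt{e}\,(d+1)\,d(\ln d+\ln\ln d+5)=O(2^dd^2\ln d);$$ otherwise, $$\mathrm{coin}_w(K)<e(d+1)\left(\binom{2d}{d}^{1/d}-1+\frac{d}{d+1}\right)^d d(\ln d+\ln\ln d+5)=O(4^dd^{3/2}\ln d).$$
   Context: A $d$-dimensional convex body is a compact convex subset of Euclidean space $\mathbb{E}^d$ with nonempty interior; it is $o$-symmetric if $K=-K$. For $m\in\mathbb{N}=\{1,2,\dots\}$, $\gamma_m(K)=\inf\{\lambda>0:K\subseteq\bigcup_{i=1}^m(\lambda K+t_i),\ t_i\in\mathbb{E}^d\}$. The weak covering index is $$\mathrm{coin}_w(K)=\inf\left\{\frac{m}{1-\gamma_m(K)}:\gamma_m(K)<1,\ m\in\mathbb{N}\right\}.$$ The $O(\cdot)$ notation is as $d\to\infty$, with absolute constants. *)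

(* Defs.v *)
From HB Require Import structures.
From mathcomp Require Import all_boot all_order all_algebra.
From mathcomp Require Import all_classical all_reals all_analysis.
Set Implicit Arguments.
Unset Strict Implicit.
Unset Printing Implicit Defensive.
Import Order.TTheory GRing.Theory Num.Theory.
Import numFieldNormedType.Exports.

Local Open Scope classical_set_scope.
Local Open Scope ring_scope.

(* Euclidean d-space is 'rV[R]_d. Only its linear structure and its topology
   matter here; the library norm on 'rV[R]_d is the max norm, which induces the
   Euclidean topology. *)

Definition convex_body (R : realType) (d : nat) (K : set 'rV[R]_d) : Prop :=
  [/\ compact K, convex_set K & K° !=set0].

Definition o_symmetric (R : realType) (d : nat) (K : set 'rV[R]_d) : Prop :=
  K = [set - x | x in K].

(* The set under the infimum is bounded below by 0, and it contains 1 as soon as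
   0 < m, so the real-valued infimum is the usual one for every m >= 1. *)
Definition gamma (R : realType) (d m : nat) (K : set 'rV[R]_d) : R :=
  inf [set l : R | 0 < l /\ exists t : 'I_m -> 'rV[R]_d,
    K `<=` \bigcup_(i in [set: 'I_m]) [set l *: x + t i | x in K]].

(* An extended-real infimum, equal to +oo when no m satisfies the condition. *)
Definition coin_w (R : realType) (d : nat) (K : set 'rV[R]_d) : \bar R :=
  ereal_inf [set (m%:R / (1 - gamma m K))%:E |
    m in [set m : nat | (0 < m)%N /\ gamma m K < 1]].

Definition symmetric_bound (R : realType) (d : nat) : R :=
  2 ^+ d * Num.sqrt (expR 1) * (d%:R + 1) * d%:R
  * (ln d%:R + ln (ln d%:R) + 5).

Definition general_bound (R : realType) (d : nat) : R :=
  expR 1 * (d%:R + 1)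
  * ('C(2 * d, d)%:R `^ (d%:R^-1) - 1 + d%:R / (d%:R + 1)) ^+ d
  * d%:R * (ln d%:R + ln (ln d%:R) + 5).

(* Main.v *)
Require Import Defs.
From HB Require Import structures.
From mathcomp Require Import all_boot all_order all_algebra.
From mathcomp Require Import all_classical all_reals all_analysis.
From mathcomp Require Import finmap zify ring lra.
Import Order.TTheory GRing.Theory Num.Theory.
Import numFieldNormedType.Exports.
Local Open Scope classical_set_scope.
Local Open Scope ring_scope.

(** Let K be a convex body with 0 in its interior, let l = d/(d+1) and L = lK.
    If m translates of L cover K, then the index is at most
    m/(1 - l) = m (d+1), so it is enough to find such a covering with
      m <= vol(K - L)/vol(L) * d (ln d + ln ln d + 5).

    The covering comes from a random choice in the manner of Rogers
    ([cover_by_homothets]). Fix 0 < h < 1. If the translates t_i + (1-h)L leave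
    uncovered a part of K - hL of volume less than vol(hL), then the larger
    translates t_i + L cover K: a point x of K outside all of them would give a
    copy x - hL of hL, inside K - hL, disjoint from every t_i + (1-h)L, because
    (1-h)L + hL = L. A translate with t uniform in K - L covers a given point of
    K - hL with probability p = vol((1-h)L)/vol(K - L), so some m translates
    leave at most (1-p)^m vol(K - hL), and any m exceeding
    (1/p) ln(vol(K - hL)/vol(hL)) will do. For d >= 3, taking h = 1/(4 d ln d)
    keeps the loss (1-h)^(-d) close to 1, and the logarithm is then about
    d (ln d + ln ln d) ([choice_of_shrinking]).

    It remains to bound vol(K - lK). If K = -K, then K - lK = (1+l)K, and
    ((1+l)/l)^d = (2 + 1/d)^d < 2^d sqrt(e). In general the Brunn-Minkowski
    inequality for K - K = (K - lK) + (1-l)(-K), together with the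
    Rogers-Shephard inequality vol(K - K) <= C(2d,d) vol(K), gives
      vol(K - lK) <= (C(2d,d)^(1/d) - 1 + l)^d vol(K)
    ([vol_difference_general]), and l^(-d) = (1 + 1/d)^d < e.

    Volume is taken to be the limit, as e tends to 0, of e^d times the number of
    points of the lattice e Z^d in the body. Each volume argument thus becomes a
    count of finitely many lattice points followed by a passage to the limit.
    The Brunn-Minkowski inequality is proved for finite subsets of Z^d
    ([brunn_minkowski_lattice]) by induction on d, from a one-dimensional
    inequality of Prekopa-Leindler type; the Rogers-Shephard inequality comes
    from counting pairs of lattice points of K by their difference
    ([rogers_shephard_lattice]). *)

Set Implicit Arguments.
Unset Strict Implicit.
Unset Printing Implicit Defensive.

(** * The Brunn-Minkowski inequality for finite subsets of Z^d *)

Lemma seq_max (disp : Order.disp_t) (T : orderType disp) (s : seq T) (x : T) :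
  x \in s -> exists2 m, m \in s & {in s, forall y, (y <= m)%O}.
Proof.
elim: s x => // a s IH x _.
case: s IH => [_|b s IH].
  by exists a; rewrite ?mem_head // => y; rewrite inE => /eqP ->.
have [m ms mP] := IH b (mem_head _ _).
exists (Order.max a m).
  by case: (leP a m) => _; rewrite inE ?ms ?orbT ?eqxx.
by move=> y; rewrite in_cons => /orP[/eqP ->|/mP ym]; rewrite le_max ?lexx ?ym ?orbT.
Qed.

(** The layer-cake principle for finite sums: matching the largest entry of a
    with an entry of b that is at least as large and removing both preserves the
    hypothesis, since it lowers both counts by one at every level where the
    count for a is not already zero. *)
Lemma sum_le_levels (R : realDomainType) (a b : seq R) :
  {in b, forall x, 0 <= x} ->
  (forall u, 0 < u ->
     (count (fun x => u <= x)%R a <= count (fun x => u <= x)%R b)%N) ->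
  \sum_(x <- a) x <= \sum_(x <- b) x.
Proof.
move: {-1}(size a) (leqnn (size a)) => n.
elim: n a b => [|n IH] a b sa b0 cab.
  by move: sa; rewrite leqn0 size_eq0 => /eqP ->; rewrite big_nil big_seq sumr_ge0.
case: (altP (@eqP _ a [::])) => [->|]; first by rewrite big_nil big_seq sumr_ge0.
move=> a0; have [x0 x0a] : exists x, x \in a.
  by case: a a0 {sa cab} => // x a _; exists x; rewrite mem_head.
have [m ma mP] := @seq_max _ _ a x0 x0a.
have [m0|m0] := lerP m 0.
  apply: (@le_trans _ _ 0); last by rewrite big_seq sumr_ge0.
  by rewrite big_seq sumr_le0 // => i /mP im; apply: le_trans m0.
have : has (fun x => m <= x) b.
  by rewrite has_count (leq_trans _ (cab m m0)) // -has_count; apply/hasP; exists m.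
move=> /hasP[y yb my].
rewrite (perm_big _ (perm_to_rem ma)) (perm_big _ (perm_to_rem yb)) /= !big_cons.
apply: lerD => //; apply: IH.
- by rewrite size_rem //; case: (size a) sa.
- by move=> x /mem_rem; apply: b0.
- move=> u u0.
  have := cab u u0.
  rewrite (permP (perm_to_rem ma)) (permP (perm_to_rem yb)) /=.
  have [um|mu] := lerP u m; first by rewrite (le_trans um my) leq_add2l.
  suff -> : count (fun x => u <= x) (rem m a) = 0%N by [].
  apply/eqP; rewrite -leqn0 leqNgt -has_count; apply/hasPn => x /mem_rem /mP xm.
  by rewrite -ltNge (le_lt_trans xm).
Qed.

(** With M = max I and m = min J, the sets I + m and M + 1 + J both lie in C and
    are separated by the gap between M + m and M + m + 1. *)
Lemma size_int_sumset (I J C : seq int) : uniq I -> uniq J ->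
  I != [::] -> J != [::] ->
  {in I & J, forall i j, (i + j \in C) && (i + j + 1 \in C)} ->
  (size I + size J <= size C)%N.
Proof.
move=> uI uJ I0 J0 IJC.
have [iI iIP] : exists i, i \in I by case: I I0 {uI IJC} => // i I _; exists i; rewrite mem_head.
have [jJ jJP] : exists j, j \in J by case: J J0 {uJ IJC} => // i J _; exists i; rewrite mem_head.
have [M MI MP] := @seq_max _ _ I iI iIP.
have [m' m'J m'P] := @seq_max _ _ _ _ (map_f (fun j => - j) jJP).
case/mapP: m'J m'P => m mJ -> mP.
rewrite -(size_map (fun i => i + m)) -(size_map (fun j => M + j + 1) J) -size_cat.
apply: uniq_leq_size.
  rewrite cat_uniq (map_inj_uniq (addIr m)) uI.
  rewrite map_inj_uniq ?uJ ?andbT => [|x y /addIr /addrI //].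
  apply/hasPn => _ /mapP[j jJ' ->]; apply/negP => /mapP[i iI' E].
  have := MP i iI'; have := mP _ (map_f (fun j => - j) jJ'); lia.
move=> x; rewrite mem_cat => /orP[] /mapP[y yP ->].
  by have /andP[] := IJC y m yP mJ.
by have /andP[] := IJC M y MI yP.
Qed.

(** Young's inequality with exponents 1/s and 1/t. *)
Lemma weighted_AGM (R : realType) (s t x y : R) : 0 < s -> 0 < t -> s + t = 1 ->
  0 <= x -> 0 <= y -> x `^ s * y `^ t <= s * x + t * y.
Proof.
move=> s0 t0 st x0 y0.
have := @conjugate_powR R (x `^ s) (y `^ t) s^-1 t^-1.
rewrite !powR_ge0 !invrK !invr_gt0 s0 t0 st -!powRrM !divff ?gt_eqF // !powRr1 //.
by move=> /(_ isT isT isT isT erefl); rewrite (mulrC x) (mulrC y).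
Qed.

(** Divide f and g by their maxima and h by the corresponding product. Then the
    level sets of h contain I' + J' + {0,1} for the level sets I' of f and J' of
    g, and at every level up to 1 both are nonempty, so [size_int_sumset] and
    the layer-cake principle bound the sum of h below by the sum of the two
    normalized sums; the weighted inequality of arithmetic and geometric means
    turns this sum into the product. *)
Lemma prekopa_leindler1 (R : realType) (s t : R) (I J C : seq int)
    (f g h : int -> R) : 0 < s -> 0 < t -> s + t = 1 ->
  uniq I -> uniq J -> {in I, forall i, 0 < f i} -> {in J, forall j, 0 < g j} ->
  {in C, forall c, 0 <= h c} ->
  (forall i j e, i \in I -> j \in J -> (e == 0) || (e == 1) ->
     i + j + e \in C /\ f i `^ s * g j `^ t <= h (i + j + e)) ->
  (\sum_(i <- I) f i) `^ s * (\sum_(j <- J) g j) `^ t <=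
    s `^ s * t `^ t * \sum_(c <- C) h c.
Proof.
move=> s0 t0 st uI uJ f0 g0 h0 fgh.
have rhs0 : 0 <= s `^ s * t `^ t * \sum_(c <- C) h c.
  by rewrite !mulr_ge0 ?powR_ge0 // big_seq sumr_ge0.
case: (altP (@eqP _ I [::])) => [->|I0]; first by rewrite big_nil powR0 ?gt_eqF // mul0r.
case: (altP (@eqP _ J [::])) => [->|J0]; first by rewrite big_nil (@powR0 _ t) ?gt_eqF // mulr0.
have [iI iIP] : exists i, i \in I by case: I I0 {uI fgh f0} => // i I _; exists i; rewrite mem_head.
have [jJ jJP] : exists j, j \in J by case: J J0 {uJ fgh g0} => // i J _; exists i; rewrite mem_head.
have [_ /mapP[i0 i0I ->] FP] := @seq_max _ _ _ _ (map_f f iIP).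
have [_ /mapP[j0 j0J ->] GP] := @seq_max _ _ _ _ (map_f g jJP).
set F := f i0 in FP *; set G := g j0 in GP *.
have F0 : 0 < F by apply: f0.
have G0 : 0 < G by apply: g0.
set M := F `^ s * G `^ t.
have M0 : 0 < M by rewrite mulr_gt0 // powR_gt0.
(* the normalized inequality, from the level sets *)
have key : \sum_(i <- I) f i / F + \sum_(j <- J) g j / G <= \sum_(c <- C) h c / M.
  rewrite -(big_map (fun i => f i / F) predT id) -(big_map (fun i => g i / G) predT id).
  rewrite -(big_map (fun i => h i / M) predT id) -big_cat /=.
  apply: sum_le_levels => [_ /mapP[c cC ->]|u u0].
    by rewrite divr_ge0 ?h0 // ltW.
  rewrite count_cat !count_map.
  have [u1|u1] := ltrP 1 u.
    have c0 (L : seq int) (k : int -> R) : {in L, forall i, k i <= 1} ->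
        count (preim k (fun x => u <= x)%R) L = 0%N.
      move=> k1; apply/eqP; rewrite -leqn0 leqNgt -has_count; apply/hasPn => x /k1 xL.
      by rewrite /= -ltNge (le_lt_trans xL).
    (* above level 1 the normalized f and g have no points left *)
    rewrite (c0 I (fun i => f i / F)) ?(c0 J (fun j => g j / G)) // => x xL.
      by rewrite ler_pdivrMr // mul1r GP // map_f.
    by rewrite ler_pdivrMr // mul1r FP // map_f.
  rewrite -!size_filter; apply: size_int_sumset; rewrite ?filter_uniq //.
  - by rewrite -has_filter; apply/hasP; exists i0 => //=; rewrite divff ?gt_eqF.
  - by rewrite -has_filter; apply/hasP; exists j0 => //=; rewrite divff ?gt_eqF.
  move=> i j; rewrite !mem_filter /= => /andP[ui iI'] /andP[uj jJ'].
  have main e : (e == 0) || (e == 1) -> (u <= h (i + j + e) / M) && (i + j + e \in C).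
    move=> /(fgh _ _ _ iI' jJ')[-> hh]; rewrite andbT ler_pdivlMr //.
    apply: le_trans hh.
    rewrite /M -[in u * _](powRr1 (ltW u0)) -st powRD; last by rewrite (gt_eqF u0) implybT.
    rewrite mulrACA -!powRM ?(ltW u0) ?(ltW F0) ?(ltW G0) //.
    by apply: ler_pM; rewrite ?powR_ge0 //; apply: ge0_ler_powR;
      rewrite ?nnegrE ?(ltW s0) ?(ltW t0) ?mulr_ge0 ?(ltW u0) ?(ltW F0) ?(ltW G0)
        ?(ltW (f0 _ _)) ?(ltW (g0 _ _)) //
       -ler_pdivlMr.
  by have := main 0 isT; rewrite addr0 => ->; apply: main.
set X := \sum_(i <- I) f i in key *; set Y := \sum_(i <- J) g i in key *.
have X0 : 0 <= X by rewrite /X big_seq sumr_ge0 // => i /f0 /ltW.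
have Y0 : 0 <= Y by rewrite /Y big_seq sumr_ge0 // => i /g0 /ltW.
rewrite -!mulr_suml -/X -/Y in key.
have := @weighted_AGM R s t (X / F / s) (Y / G / t) s0 t0 st.
have XF0 : 0 <= X / F by rewrite divr_ge0 // ltW.
have YG0 : 0 <= Y / G by rewrite divr_ge0 // ltW.
rewrite !divr_ge0 ?(ltW s0) ?(ltW t0) ?(ltW F0) ?(ltW G0) //.
move=> /(_ isT isT).
rewrite [s * _]mulrC [t * _]mulrC !divfK ?gt_eqF // => /le_trans /(_ key).
rewrite ler_pdivlMr // => H.
have ss : 0 < s `^ s * t `^ t by rewrite mulr_gt0 // powR_gt0.
rewrite -(ler_pM2l ss) in H; apply: le_trans H.
have E (x y z w : R) : 0 <= x -> 0 < y -> 0 < z ->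
    z `^ w * ((x / y / z) `^ w * y `^ w) = x `^ w.
  move=> x0 y0 z0.
  have q0 : 0 <= x / y / z by apply: divr_ge0; [apply: divr_ge0|]; rewrite // ltW.
  have q1 : 0 <= x / y / z * y by rewrite mulr_ge0 // ltW.
  rewrite -(powRM _ q0 (ltW y0)) -(powRM _ (ltW z0) q1).
  by rewrite mulrCA mulrA !divfK ?gt_eqF.
rewrite -{1}(E X F s s X0 F0 s0) -{1}(E Y G t t Y0 G0 t0) /M le_eqVlt; apply/orP; left; apply/eqP.
by rewrite mulrACA; congr (_ * _); rewrite mulrACA.
Qed.

Definition slice d (A : seq 'rV[int]_(1 + d)) (x : int) : seq 'rV[int]_d :=
  [seq rsubmx a | a <- A & lsubmx a 0 0 == x].

Lemma first_rest d (a : 'rV[int]_(1 + d)) :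
  a = row_mx (lsubmx a 0 0)%:M (rsubmx a).
Proof. by rewrite -mx11_scalar hsubmxK. Qed.

Lemma mem_slice d (A : seq 'rV[int]_(1 + d)) x (y : 'rV[int]_d) :
  (y \in slice A x) = ((row_mx x%:M y : 'rV[int]_(1 + d)) \in A).
Proof.
apply/mapP/idP => [[a + ->]|yA].
  by rewrite mem_filter => /andP[/eqP <- aA]; rewrite -first_rest.
exists (row_mx x%:M y); last by rewrite row_mxKr.
by rewrite mem_filter yA row_mxKl mxE eqxx mulr1n eqxx.
Qed.

Lemma slice_uniq d (A : seq 'rV[int]_(1 + d)) x : uniq A -> uniq (slice A x).
Proof.
move=> uA; rewrite map_inj_in_uniq ?filter_uniq // => a b.
rewrite !mem_filter => /andP[/eqP ax _] /andP[/eqP bx _] ab.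
by rewrite [LHS]first_rest [RHS]first_rest ax bx ab.
Qed.

Lemma sum_size_slices d (A : seq 'rV[int]_(1 + d)) :
  (\sum_(x <- undup [seq lsubmx a ord0 ord0 | a <- A]) size (slice A x))%N = size A.
Proof.
under eq_bigr do rewrite size_map size_filter.
rewrite -[RHS](count_predT A).
set s := undup _.
have sP a : a \in A -> lsubmx a 0 0 \in s.
  by move=> aA; rewrite mem_undup (map_f (fun a : 'rV_(1 + d) => lsubmx a 0 0)).
have su : uniq s by apply: undup_uniq.
clearbody s.
elim: A sP => [_|a A IH sP] /=; first by rewrite big1.
rewrite big_split /= IH => [|b bA]; last by apply: sP; rewrite inE bA orbT.
rewrite (bigD1_seq (lsubmx a 0 0)) ?sP ?mem_head //= eqxx.
by rewrite big1 ?addn0 ?add1n // => i /negPf; rewrite eq_sym => ->.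
Qed.

(** Adding {0,1}^d to A + B replaces points by unit cubes. The factor
    (s^s t^t)^d is the one for which an optimal choice of s and t recovers
    (|A|^(1/d) + |B|^(1/d))^d <= |C|. In the induction step, the sizes of the
    slices satisfy the hypothesis of [prekopa_leindler1] by the induction
    hypothesis. *)
Lemma brunn_minkowski_lattice (R : realType) d (s t : R) (A B C : seq 'rV[int]_d) :
  0 < s -> 0 < t -> s + t = 1 -> uniq A -> uniq B ->
  (forall a b (q : 'rV[int]_d), a \in A -> b \in B ->
     (forall i j, (q i j == 0) || (q i j == 1)) -> a + b + q \in C) ->
  (size A)%:R `^ s * (size B)%:R `^ t <= (s `^ s * t `^ t) ^+ d * (size C)%:R.
Proof.
move=> s0 t0 st; elim: d A B C => [|d IH] A B C uA uB ABC.
  rewrite expr0 mul1r.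
  have small (D : seq 'rV[int]_0) : uniq D -> D = [::] \/ D = [:: 0].
    case: D => [|x [|y D]]; [by left| by right; rewrite thinmx0|].
    by rewrite (thinmx0 x) (thinmx0 y) /= inE eqxx.
  have [->|A0] := small A uA; first by rewrite powR0 ?gt_eqF // mul0r.
  have [->|B0] := small B uB; first by rewrite (@powR0 _ t) ?gt_eqF // mulr0.
  have : 0 + 0 + 0 \in C by apply: ABC; rewrite ?A0 ?B0 ?mem_head // => i [].
  rewrite A0 B0.
  by case: C {ABC} => // c C _; rewrite /= !powR1 mulr1 ler1n.
set fst := fun a : 'rV[int]_(1 + d) => lsubmx a 0 0.
set I := undup (map fst A); set J := undup (map fst B); set K := undup (map fst C).
set k := (s `^ s * t `^ t) ^+ d.
have k0 : 0 <= k by rewrite exprn_ge0 // mulr_ge0 // powR_ge0.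
have sizeS (D : seq 'rV[int]_(1 + d)) :
    (size D)%:R = \sum_(x <- undup (map fst D)) (size (slice D x))%:R :> R.
  by rewrite -[in LHS]sum_size_slices natr_sum.
have inS (D : seq 'rV[int]_(1 + d)) x : x \in undup (map fst D) ->
    exists y, y \in slice D x.
  rewrite mem_undup => /mapP[a aD ->]; exists (rsubmx a).
  by rewrite mem_slice -first_rest.
rewrite (sizeS A) (sizeS B) (sizeS C).
apply: (@le_trans _ _ (s `^ s * t `^ t * \sum_(x <- K) k * (size (slice C x))%:R)); last first.
  by rewrite -mulr_sumr mulrA -exprS.
apply: prekopa_leindler1 => //; rewrite ?undup_uniq //.
- by move=> i /inS[y]; rewrite ltr0n; case: (slice A i).
- by move=> i /inS[y]; rewrite ltr0n; case: (slice B i).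
- by move=> i _; rewrite mulr_ge0 // ler0n.
move=> i j e iI jJ e01.
have sub a b (q : 'rV[int]_d) : a \in slice A i -> b \in slice B j ->
    (forall i j, (q i j == 0) || (q i j == 1)) -> a + b + q \in slice C (i + j + e).
  rewrite !mem_slice => aA bB q01.
  rewrite !raddfD /= -!add_row_mx; apply: ABC => // i' j'.
  rewrite mxE; case: splitP => j'' _; last exact: q01.
  by rewrite !ord1 mxE eqxx mulr1n.
split.
  have [y yA] := inS _ _ iI; have [z zB] := inS _ _ jJ.
  have := sub y z 0 yA zB (fun _ _ => _).
  rewrite mem_slice mem_undup => yzC; apply/mapP; eexists; first apply: yzC.
    by move=> u v; rewrite mxE eqxx.
  by rewrite /fst row_mxKl mxE eqxx mulr1n.
by apply: IH => //; apply: slice_uniq.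
Qed.

(** * Lattice points of convex sets *)

Section Lattice.
Context {R : realType} {d : nat}.
Implicit Types (S T : set 'rV[R]_d) (z : 'rV[int]_d).

Definition box (r : R) : set 'rV[R]_d := [set x | forall j, `|x 0 j| <= r].

(** Dilation by c, written as a preimage so that the points of e Z^d in cS are,
    without any bijection, those of (e/c) Z^d in S. *)
Definition dil (c : R) S : set 'rV[R]_d := [set x | S (c^-1 *: x)].

Definition lat (e : R) z : 'rV[R]_d := e *: map_mx intr z.

Definition pts (e : R) S : seq 'rV[int]_d := fset_set [set z | S (lat e z)].

Lemma latE e z j : lat e z 0 j = e * (z 0 j)%:~R.
Proof. by rewrite !mxE. Qed.

Lemma latD e z1 z2 : lat e (z1 + z2) = lat e z1 + lat e z2.
Proof. by rewrite /lat map_mxD scalerDr. Qed.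

Lemma latN e z : lat e (- z) = - lat e z.
Proof. by rewrite /lat map_mxN scalerN. Qed.

Lemma lat_finite e S M : 0 < e -> S `<=` box M -> finite_set [set z | S (lat e z)].
Proof.
move=> e0 SM.
set m := `|Num.ceil (M / e)|%N.
pose g (w : 'rV['I_(2 * m).+1]_d) : 'rV[int]_d := \row_j ((w 0 j)%:Z - m%:Z).
apply: (@sub_finite_set _ _ [set` [seq g w | w <- enum [set: 'rV['I_(2 * m).+1]_d]%SET]]);
  last exact: finite_seq.
move=> z /= Sz; have zm j : `|z 0 j| <= m%:Z.
  have := SM _ Sz j; rewrite latE normrM (gtr0_norm e0) mulrC -ler_pdivlMr //.
  rewrite -intr_norm => /le_trans /(_ (ceil_ge _)).
  by rewrite ler_int => zm; rewrite (le_trans zm) // /m abszE ler_norm.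
apply/mapP; exists (\row_j inord `|(z 0 j + m%:Z)%R|%N).
  by rewrite mem_enum inE.
apply/rowP => j; rewrite !mxE inordK; have := zm j; lia.
Qed.

Lemma mem_pts e S M z : 0 < e -> S `<=` box M -> (z \in pts e S) <-> S (lat e z).
Proof.
move=> e0 SM; rewrite /pts in_fset_set; last exact: lat_finite SM.
by rewrite in_setE.
Qed.

Lemma pts_uniq e S : uniq (pts e S).
Proof. exact: fset_uniq. Qed.

Lemma size_pts_le e S T M : 0 < e -> S `<=` T -> T `<=` box M ->
  (size (pts e S) <= size (pts e T))%N.
Proof.
move=> e0 ST TM; apply: uniq_leq_size; first exact: pts_uniq.
move=> z /(mem_pts z e0 (subset_trans ST TM)) /ST zT.
by apply/(mem_pts z e0 TM).
Qed.

Lemma pts_dil e c S : 0 < c -> pts e (dil c S) = pts (e / c) S.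
Proof.
move=> c0; rewrite /pts; congr (enum_fset (fset_set _)).
by apply/seteqP; split => z; rewrite /= /dil /lat /= scalerA mulrC.
Qed.

Definition cvx S := forall x y (a b : R), S x -> S y -> 0 <= a -> 0 <= b ->
  a + b = 1 -> S (a *: x + b *: y).

Lemma box_round e (x : 'rV[R]_d) : 0 < e ->
  exists z, box e (x - lat e z) /\ forall j, 0 <= x 0 j - e * (z 0 j)%:~R < e.
Proof.
move=> e0; exists (\row_j Num.floor (x 0 j / e)).
have H j : 0 <= x 0 j - e * ((\row_j Num.floor (x 0 j / e)) 0 j)%:~R < e.
  rewrite mxE; have /andP[] := floor_itv (x 0 j / e); set f := Num.floor _ => h1 h2.
  rewrite ler_pdivlMr // in h1; rewrite ltr_pdivrMr // intrD in h2.
  by apply/andP; split; lra.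
split => // j; have /andP[h0 h1] := H j.
by rewrite mxE [X in _ + X]mxE latE ger0_norm // ltW.
Qed.

(** Rounding down to the coarse lattice e Z^d moves a point of S by at most e in
    each coordinate, hence into (1 + e/r)S; and each coarse cell contains at most
    (e/e' + 1)^d points of the fine lattice e' Z^d. Comparing two scales in this
    way is all that the existence of volumes depends on. *)
Lemma size_pts_refine S r M (e e' : R) : cvx S -> 0 < r -> box r `<=` S ->
  S `<=` box M -> 0 < e -> 0 < e' ->
  (size (pts e' S))%:R <=
    (e / e' + 1) ^+ d * (size (pts e (dil (1 + e / r) S)))%:R :> R.
Proof.
move=> cS r0 rS SM e0 e'0.
set c := 1 + e / r.
have er0 : 0 < e / r by rewrite divr_gt0.
have c0 : 0 < c by rewrite /c; lra.
have dilM : dil c S `<=` box (c * M).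
  move=> x /SM xM j; have := xM j; rewrite mxE normrM gtr0_norm ?invr_gt0 //.
  by rewrite ler_pdivrMl.
have nS x y : S x -> box e y -> dil c S (x + y).
  move=> Sx ye; rewrite /dil /=.
  have -> : c^-1 *: (x + y) = c^-1 *: x + (c^-1 * (e / r)) *: ((r / e) *: y).
    rewrite scalerA scalerDr; congr (_ + _ *: _).
    by rewrite -mulrA -[X in _ = _ * X]mulrA (mulrA _ r) mulVf ?mul1r ?mulfV ?mulr1 ?gt_eqF.
  apply: cS => //.
  - apply: rS => j; rewrite mxE normrM gtr0_norm ?divr_gt0 //.
    by rewrite mulrAC ler_pdivrMr // ler_pM2l.
  - by rewrite invr_ge0 ltW.
  - by rewrite mulr_ge0 // ?invr_ge0 ltW.
  - by rewrite -{1}[c^-1]mulr1 -mulrDr mulVf // gt_eqF.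
have [rd Hrd] := choice (fun x => box_round x e0).
set m := `|Num.floor (e / e')|%N.+1.
have mE : m%:R <= e / e' + 1 :> R.
  rewrite /m -natr1 lerD2r; have f0 : 0 <= Num.floor (e / e') by rewrite floor_ge0 divr_ge0 ?ltW.
  by rewrite natr_absz ger0_norm ?ler_int // floor_le.
(* the position of w in its coarse cell, counted from the least fine coordinate *)
pose off (w : 'rV[int]_d) : 'rV['I_m]_d :=
  \row_j inord `|(w 0 j - Num.ceil (e * (rd (lat e' w) 0 j)%:~R / e'))%R|%N.
have offE w j : (off w 0 j : nat)%:Z = w 0 j - Num.ceil (e * (rd (lat e' w) 0 j)%:~R / e').
  have [_ /(_ j)] := Hrd (lat e' w).
  rewrite latE => /andP[h1 h2].
  rewrite mxE.
  set k := rd _ 0 j in h1 h2 *.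
  have a1 : Num.ceil (e * k%:~R / e') <= w 0 j.
    by rewrite ceil_le_int ler_pdivrMr // mulrC; move: h1; lra.
  rewrite inordK; first by lia.
  have : w 0 j - Num.ceil (e * k%:~R / e') <= Num.floor (e / e').
    rewrite floor_ge_int intrB lerBlDr.
    have := ceil_ge (e * k%:~R / e').
    have : (w 0 j)%:~R <= e / e' + e * k%:~R / e'.
      by rewrite -mulrDl ler_pdivlMr // mulrC; move: h2; lra.
    lra.
  rewrite /m; lia.
pose f w := (rd (lat e' w), off w).
have finj : injective f.
  move=> w1 w2 [E1 E2]; apply/rowP => j.
  by have := offE w1 j; have := offE w2 j; rewrite E1 E2 => -> /addIr.
have : (size (map f (pts e' S)) <=
  size [seq (u, v) | u <- pts e (dil c S), v <- enum [set: 'rV['I_m]_d]%SET])%N.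
  apply: uniq_leq_size; first by rewrite map_inj_uniq ?pts_uniq.
  move=> _ /mapP[w /(mem_pts w e'0 SM) wS ->].
  apply: allpairs_f; last by rewrite mem_enum inE.
  apply/(mem_pts _ e0 dilM).
  have -> : lat e (rd (lat e' w)) = lat e' w + - (lat e' w - lat e (rd (lat e' w))).
    by rewrite opprB addrC subrK.
  apply: nS => // j; rewrite mxE normrN.
  by have [/(_ j)] := Hrd (lat e' w).
rewrite size_map size_allpairs -cardE cardsT card_mx card_ord mul1n => H.
apply: (@le_trans _ _ ((size (pts e (dil c S)) * m ^ d)%N%:R)); first by rewrite ler_nat.
rewrite natrM mulrC natrX ler_wpM2r // lerXn2r // nnegrE ?ler0n //.
by rewrite addr_ge0 ?divr_ge0 ?ltW.
Qed.

End Lattice.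

(** * Volume as a limit of lattice point counts *)

Lemma cvg_expr (R : realType) (T : Type) (F : set_system T) (FF : Filter F)
    (f : T -> R) (a : R) n :
  f x @[x --> F] --> a -> f x ^+ n @[x --> F] --> a ^+ n.
Proof.
move=> fa; elim: n => [|n IH]; first by under eq_fun do rewrite expr0; exact: cvg_cst.
by under eq_fun do rewrite exprS; rewrite exprS; apply: (@cvgM _ _ _ _ f (fun x => f x ^+ n)).
Qed.

Section Volume.
Context {R : realType} {d : nat}.
Implicit Types (S T : set 'rV[R]_d).

(** Boundedness and a neighbourhood of 0 are both expressed by boxes, which a
    count of integer points can reach coordinate by coordinate. *)
Definition fat S := [/\ cvx S, exists2 r : R, 0 < r & box r `<=` S
  & exists M : R, S `<=` box M].

Definition density S (e : R) : R := e ^+ d * (size (pts e S))%:R.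

Definition vol S : R := lim (density S e @[e --> 0^'+]).

Lemma density_ge0 S e : 0 < e -> 0 <= density S e.
Proof. by move=> e0; rewrite mulr_ge0 // exprn_ge0 // ltW. Qed.

(** The estimate [size_pts_refine] for the coarse lattice e (r/(r-e)) Z^d, for
    which dilating S back leads exactly to the lattice e Z^d. *)
Lemma density_refine S r M (e e' : R) : cvx S -> 0 < r -> box r `<=` S ->
  S `<=` box M -> 0 < e < r -> 0 < e' ->
  density S e' <= (r / (r - e) + e' / e) ^+ d * density S e.
Proof.
move=> cS r0 rS SM /andP[e0 er] e'0; rewrite /density.
have re0 : 0 < r - e by rewrite subr_gt0.
set f := e * (r / (r - e)).
have f0 : 0 < f by rewrite mulr_gt0 // divr_gt0.
have := size_pts_refine cS r0 rS SM f0 e'0.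
rewrite pts_dil ?addr_gt0 ?divr_gt0 //.
have -> : f / (1 + f / r) = e.
  rewrite /f; field; rewrite !gt_eqF //=; lra.
rewrite -(ler_pM2l (exprn_gt0 d e'0)) => /le_trans; apply.
rewrite !mulrA -!exprMn le_eqVlt; apply/orP; left; apply/eqP; congr (_ ^+ _ * _).
by rewrite /f; field; rewrite !gt_eqF.
Qed.

(** Volumes are positive because of this: the box of radius r alone contains the
    points with coordinates e k, 0 <= k <= r/e. *)
Lemma density_lower S r M (e : R) : 0 < r -> box r `<=` S -> S `<=` box M ->
  0 < e -> r ^+ d <= density S e.
Proof.
move=> r0 rS SM e0; rewrite /density.
set m := `|Num.floor (r / e)|%N.
have f0 : 0 <= Num.floor (r / e) by rewrite floor_ge0 divr_ge0 ?ltW.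
have mE : ((m%:Z)%:~R : R) <= r / e < ((m%:Z)%:~R : R) + 1.
  rewrite /m abszE ger0_norm // floor_le; have := floorD1_gt (r / e).
  by rewrite intrD => ->.
pose g (w : 'rV['I_m.+1]_d) : 'rV[int]_d := \row_j (w 0 j : nat)%:Z.
have : (size (map g (enum [set: 'rV['I_m.+1]_d]%SET)) <= size (pts e S))%N.
  apply: uniq_leq_size.
    rewrite map_inj_uniq ?enum_uniq // => w1 w2 /rowP E; apply/rowP => j.
    by have := E j; rewrite !mxE => -[] /val_inj.
  move=> _ /mapP[w _ ->]; apply/(mem_pts _ e0 SM); apply: rS => j.
  rewrite latE !mxE normrM (gtr0_norm e0) ger0_norm ?ler0z // mulrC -ler_pdivlMr //.
  have /andP[h _] := mE; apply: le_trans h; rewrite ler_int.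
  by rewrite lez_nat -ltnS ltn_ord.
rewrite size_map -cardE cardsT card_mx card_ord mul1n -(ler_nat R) => h.
apply: (@le_trans _ _ (e ^+ d * (m.+1 ^ d)%N%:R)); last first.
  by apply: ler_wpM2l => //; rewrite exprn_ge0 // ltW.
rewrite natrX -exprMn lerXn2r ?nnegrE ?mulr_ge0 ?(ltW e0) ?(ltW r0) //.
by rewrite mulrC -ler_pdivrMr // -natr1; have /andP[_ /ltW] := mE.
Qed.

(** The limit is the infimum v of (r/(r-e))^d density(e): by definition
    density(e) >= v ((r-e)/r)^d, while [density_refine] at a scale e that nearly
    attains the infimum bounds all densities at much finer scales. *)
Lemma vol_cvg_gt0 S : fat S -> density S e @[e --> 0^'+] --> vol S /\ 0 < vol S.
Proof.
move=> [cS [r r0 rS] [M SM]].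
set A := [set (r / (r - e)) ^+ d * density S e | e in [set e | 0 < e < r]].
have half : 0 < r / 2 < r by lra.
have lbA : lbound A (r ^+ d).
  move=> _ [e /= /andP[e0 er] <-].
  apply: (le_trans (density_lower r0 rS SM e0)).
  rewrite ler_peMl ?density_ge0 // exprn_ege1 // ler_pdivlMr; lra.
have iA : has_inf A.
  split; last by exists (r ^+ d).
  by exists ((r / (r - r / 2)) ^+ d * density S (r / 2)), (r / 2).
set v := inf A.
have vr : r ^+ d <= v by apply: lb_le_inf => //; case: iA.
have v0 : 0 < v by apply: lt_le_trans vr; rewrite exprn_gt0.
have id0 : e @[e --> (0:R)^'+] --> (0 : R) by apply: cvg_at_right_filter; exact: cvg_id.
suff cv : density S e @[e --> 0^'+] --> v.
  by rewrite /vol (cvg_lim _ cv).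
apply/cvgrPdist_lt => n n0.
(* a scale e1 that nearly attains the infimum controls all finer scales *)
have up : \forall e \near 0^'+, density S e < v + n.
  have [_ [e1 /= e1r <-]] := inf_adherent n0 iA; rewrite -/v => h1.
  have cv : (r / (r - e1) + e / e1) ^+ d * density S e1 @[e --> (0:R)^'+] -->
     (r / (r - e1) + 0 / e1) ^+ d * density S e1.
    apply: (@cvgM _ _ _ _ (fun e => (r / (r - e1) + e / e1) ^+ d)
      (fun=> density S e1)); last exact: cvg_cst.
    apply: cvg_expr; apply: (@cvgD _ _ _ _ _ (fun=> _) (fun e => e / e1)); first exact: cvg_cst.
    by apply: (@cvgM _ _ _ _ id (fun=> _)) => //; exact: cvg_cst.
  rewrite mul0r addr0 in cv.
  near=> e; apply: (@le_lt_trans _ _ ((r / (r - e1) + e / e1) ^+ d * density S e1)).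
    by apply: (density_refine cS r0 rS SM) => //; near: e; apply: nbhs_right_gt.
  by near: e; apply: (cvgr_lt _ cv).
have low : \forall e \near 0^'+, v - n < density S e.
  have cv : v * ((r - e) / r) ^+ d @[e --> (0:R)^'+] --> v * ((r - 0) / r) ^+ d.
    apply: (@cvgM _ _ _ _ (fun=> v) (fun e => ((r - e) / r) ^+ d)); first exact: cvg_cst.
    apply: cvg_expr; apply: (@cvgM _ _ _ _ (fun e => r - e) (fun=> _)); last exact: cvg_cst.
    by apply: (@cvgB _ _ _ _ _ (fun=> r) id) => //; exact: cvg_cst.
  rewrite subr0 divff ?gt_eqF // expr1n mulr1 in cv.
  near=> e; apply: (@lt_le_trans _ _ (v * ((r - e) / r) ^+ d)).
    by near: e; apply: (cvgr_gt _ cv); rewrite ltrBlDr ltrDl.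
  have e0 : 0 < e by near: e; apply: nbhs_right_gt.
  have er : e < r by near: e; apply: nbhs_right_lt.
  have re0 : 0 < r - e by rewrite subr_gt0.
  have : v <= (r / (r - e)) ^+ d * density S e.
    by apply: ge_inf; [exists (r ^+ d)|exists e => //=; rewrite e0 er].
  rewrite -(ler_pM2r (exprn_gt0 d (divr_gt0 re0 r0))) => /le_trans; apply.
  rewrite mulrAC -exprMn le_eqVlt; apply/orP; left; apply/eqP.
  suff -> : r / (r - e) * ((r - e) / r) = 1 by rewrite expr1n mul1r.
  by field; rewrite !gt_eqF.
near=> e; rewrite distrC lter_distl; apply/andP; split; by near: e.
Unshelve. all: by end_near.
Qed.

Lemma vol_cvg S : fat S -> density S e @[e --> 0^'+] --> vol S.
Proof. by case/vol_cvg_gt0. Qed.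

Lemma vol_gt0 S : fat S -> 0 < vol S.
Proof. by case/vol_cvg_gt0. Qed.

Lemma vol_dil c S : 0 < c -> fat S -> vol (dil c S) = c ^+ d * vol S.
Proof.
move=> c0 fS; apply: cvg_lim => //.
have -> : density (dil c S) = fun e => c ^+ d * density S (e / c).
  apply/funext => e; rewrite /density pts_dil // mulrA -exprMn.
  by rewrite mulrCA divff ?gt_eqF // mulr1.
apply: (@cvgM _ _ _ _ (fun=> _) (fun e => density S (e / c))); first exact: cvg_cst.
apply: (@cvg_comp _ _ _ (fun e => e / c) (density S) _ _ _ _ (vol_cvg fS)).
move=> P [n /= n0 nP].
exists (n * c) => /=; first by rewrite mulr_gt0.
move=> e; rewrite /= sub0r normrN => en e0; apply: nP => /=; last by rewrite divr_gt0.
by rewrite sub0r normrN normrM (gtr0_norm (_ : 0 < c^-1)) ?invr_gt0 // ltr_pdivrMr.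
Qed.

End Volume.

(** * The bodies aK - bK *)

Section Bodies.
Context {R : realType} {d : nat}.
Implicit Types (S T K : set 'rV[R]_d).

(** Both K = 1K - 0K and all the bodies built from it in the proof (homothets,
    reflections and difference bodies) have this form, which dilation and
    Minkowski addition preserve. *)
Definition mink (a b : R) K : set 'rV[R]_d :=
  [set x | exists u v, [/\ K u, K v & x = a *: u - b *: v]].

Definition trans (w : 'rV[R]_d) S : set 'rV[R]_d := [set x | S (x - w)].

Lemma mink0 a b K : K 0 -> mink a b K 0.
Proof. by move=> K0; exists 0, 0; rewrite !scaler0 subr0. Qed.

Lemma minkN a b K x : mink a b K x -> mink b a K (- x).
Proof. by case=> u [v [Ku Kv ->]]; exists v, u; split => //; rewrite opprB. Qed.

Lemma dil_mink c a b K : 0 < c -> dil c (mink a b K) = mink (c * a) (c * b) K.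
Proof.
move=> c0; apply/seteqP; split => x [u [v [Ku Kv E]]]; exists u, v; split => //.
  by rewrite -!scalerA -scalerBr -E scalerA mulfV ?scale1r // gt_eqF.
by rewrite E -!scalerA -scalerBr scalerA mulVf ?scale1r // gt_eqF.
Qed.

Lemma cvx_comb K a b u v : cvx K -> K u -> K v -> 0 <= a -> 0 <= b ->
  exists2 w, K w & a *: u + b *: v = (a + b) *: w.
Proof.
move=> cK Ku Kv a0 b0; have [ab|ab] := eqVneq (a + b) 0.
  have aE : a = 0 by lra.
  have bE : b = 0 by lra.
  by exists u; rewrite // aE bE addr0 !scale0r addr0.
have ab0 : 0 < a + b by rewrite lt_neqAle eq_sym ab addr_ge0.
exists ((a / (a + b)) *: u + (b / (a + b)) *: v).
  by apply: cK; rewrite ?divr_ge0 ?(ltW ab0) // -mulrDl mulfV.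
by rewrite scalerDr !scalerA !(mulrC (a + b)) !divfK.
Qed.

Lemma minkD K a b a' b' x y : cvx K -> 0 <= a -> 0 <= b -> 0 <= a' -> 0 <= b' ->
  mink a b K x -> mink a' b' K y -> mink (a + a') (b + b') K (x + y).
Proof.
move=> cK a0 b0 a'0 b'0 [u [v [Ku Kv ->]]] [u' [v' [Ku' Kv' ->]]].
have [w Kw wE] := cvx_comb cK Ku Ku' a0 a'0.
have [w' Kw' w'E] := cvx_comb cK Kv Kv' b0 b'0.
by exists w, w'; split => //; rewrite -wE -w'E opprD addrACA.
Qed.

Lemma mink_sub K a b a' b' : cvx K -> K 0 -> 0 <= a -> 0 <= b -> a <= a' -> b <= b' ->
  mink a b K `<=` mink a' b' K.
Proof.
move=> cK K0 a0 b0 aa bb x xm.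
have := minkD cK a0 b0 (_ : 0 <= a' - a) (_ : 0 <= b' - b) xm (mink0 (a' - a) (b' - b) K0).
by rewrite !subr_ge0 aa bb addr0 (addrC a) subrK (addrC b) subrK; apply.
Qed.

Lemma mink_ball K r a b : box r `<=` K -> 0 <= a -> 0 <= b -> 0 < a + b ->
  box ((a + b) * r) `<=` mink a b K.
Proof.
move=> rK a0 b0 ab x xb.
have yb : box r ((a + b)^-1 *: x).
  move=> j; rewrite mxE normrM gtr0_norm ?invr_gt0 // ler_pdivrMl //; exact: xb.
exists ((a + b)^-1 *: x), (- ((a + b)^-1 *: x)); split; first exact: rK.
  by apply: rK => j; rewrite mxE normrN.
by rewrite scalerN opprK !scalerA -scalerDl -mulrDl mulfV ?scale1r // gt_eqF.
Qed.

Lemma mink_fat K a b : fat K -> 0 <= a -> 0 <= b -> 0 < a + b -> fat (mink a b K).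
Proof.
move=> [cK [r r0 rK] [M KM]] a0 b0 ab; split.
- move=> x y s t xK yK s0 t0 st.
  have scale c z : 0 <= c -> mink a b K z -> mink (c * a) (c * b) K (c *: z).
    move=> _ [u [v [Ku Kv ->]]]; exists u, v; split => //.
    by rewrite scalerBr !scalerA.
  have := minkD cK _ _ _ _ (scale _ _ s0 xK) (scale _ _ t0 yK).
  by rewrite -!mulrDl st !mul1r; apply; rewrite mulr_ge0.
- by exists ((a + b) * r); [rewrite mulr_gt0|apply: mink_ball].
- exists (a * M + b * M) => _ [u [v [/KM uM /KM vM ->]]] j.
  rewrite !mxE (le_trans (ler_normB _ _)) // !normrM (ger0_norm a0) (ger0_norm b0).
  by rewrite lerD // ler_wpM2l.
Qed.

Lemma fat0 K : fat K -> K 0.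
Proof. by case=> _ [r r0 rK] _; apply: rK => j; rewrite mxE normr0 ltW. Qed.

Lemma vol_mink_scale K c a b : fat K -> 0 < c -> 0 <= a -> 0 <= b -> 0 < a + b ->
  vol (mink (c * a) (c * b) K) = c ^+ d * vol (mink a b K).
Proof. by move=> fK c0 a0 b0 ab; rewrite -dil_mink // vol_dil //; apply: mink_fat. Qed.

Lemma size_pts_minkN e K a b : 0 < e -> fat K -> 0 <= a -> 0 <= b -> 0 < a + b ->
  size (pts e (mink a b K)) = size (pts e (mink b a K)).
Proof.
move=> e0 fK.
suff h a' b' : 0 <= a' -> 0 <= b' -> 0 < a' + b' ->
    (size (pts e (mink a' b' K)) <= size (pts e (mink b' a' K)))%N.
  by move=> a0 b0 ab; apply/eqP; rewrite eqn_leq !h // addrC.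
move=> a0 b0 ab.
have [_ _ [M1 M1P]] := mink_fat fK a0 b0 ab.
have [_ _ [M2 M2P]] := mink_fat fK b0 a0 (eq_ind _ (fun x => 0 < x) ab _ (addrC _ _)).
rewrite -(size_map (fun z => - z)); apply: uniq_leq_size.
  by rewrite map_inj_uniq ?pts_uniq //; exact: oppr_inj.
move=> _ /mapP[z /(mem_pts z e0 M1P) zK ->]; apply/(mem_pts _ e0 M2P).
by rewrite latN; apply: minkN.
Qed.

Lemma vol_minkN K a b : fat K -> 0 <= a -> 0 <= b -> 0 < a + b ->
  vol (mink a b K) = vol (mink b a K).
Proof.
move=> fK a0 b0 ab; apply: cvg_lim => //.
have := vol_cvg (mink_fat fK b0 a0 (eq_ind _ (fun x => 0 < x) ab _ (addrC _ _))).
apply: cvg_trans; apply: near_eq_cvg; near=> e.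
rewrite /density size_pts_minkN //.
by rewrite addrC.
Unshelve. all: by end_near.
Qed.

(** A translation vector is a lattice vector up to an error of at most e in each
    coordinate, which the gap between (1 - dl)S and S absorbs. The bound is
    uniform in w, and this is what allows translates depending on the lattice. *)
Lemma size_pts_translate S dl : fat S -> 0 < dl < 1 ->
  \forall e \near 0^'+, forall w,
    (size (pts e (dil (1 - dl)%R S)) <= size (pts e (trans w S)))%N.
Proof.
move=> [cS [r r0 rS] [M SM]] /andP[dl0 dl1]; near=> e => w.
have e0 : 0 < e by near: e; apply: nbhs_right_gt.
have er : e <= dl * r by near: e; apply: nbhs_right_le; rewrite mulr_gt0.
have ddl : 0 < 1 - dl by rewrite subr_gt0.
have [z [zb _]] := box_round w e0.
set M1 := (1 - dl) * M.
have dM : dil (1 - dl) S `<=` box M1.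
  move=> x /SM xM j; have := xM j; rewrite mxE normrM gtr0_norm ?invr_gt0 //.
  by rewrite ler_pdivrMl.
have [M2 TM] : exists M2, trans w S `<=` box M2.
  exists (M + \sum_j `|w 0 j|) => x /SM xM j; have := xM j; rewrite !mxE => xj.
  have wj : `|w 0 j| <= \sum_j `|w 0 j| by rewrite (bigD1 j) //= lerDl sumr_ge0.
  have := ler_normD (x 0 j - w 0 j) (w 0 j); rewrite subrK => h.
  by rewrite (le_trans h) // lerD.
rewrite -(size_map (fun y => y + z)); apply: uniq_leq_size.
  by rewrite map_inj_uniq ?pts_uniq //; exact: addIr.
move=> _ /mapP[y /(mem_pts y e0 dM) yS ->]; apply/(mem_pts _ e0 TM); rewrite /trans /=.
rewrite latD -addrA -[_ - w]opprB.
set f := w - _ in zb *.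
move: (lat e y) yS => p pS.
have -> : p - f = (1 - dl) *: ((1 - dl)^-1 *: p) + dl *: (- (dl^-1 *: f)).
  by rewrite scalerN !scalerA !mulfV ?gt_eqF // !scale1r.
apply: cS => //; rewrite ?(ltW dl0) ?(ltW ddl) ?subrK //.
apply: rS => j; rewrite !mxE normrN normrM gtr0_norm ?invr_gt0 // ler_pdivrMl //.
by apply: le_trans er; have := zb j; rewrite !mxE.
Unshelve. all: by end_near.
Qed.

End Bodies.

(** * The Brunn-Minkowski inequality for volumes *)

Lemma le_near0 (R : realType) (f : R -> R) (x y : R) :
  f dl @[dl --> 0^'+] --> x -> (forall dl, 0 < dl < 1 -> f dl <= y) -> x <= y.
Proof.
move=> fx fy; apply: (@ler_cvg_to _ _ _ R f (fun=> y) x y fx (@cvg_cst _ _ _ _ _)).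
near=> dl; apply: fy; apply/andP; split; near: dl.
  exact: nbhs_right_gt.
exact: nbhs_right_lt.
Unshelve. all: by end_near.
Qed.

Lemma cvg_id_right0 (R : realType) : e @[e --> (0 : R)^'+] --> (0 : R).
Proof. by apply: cvg_at_right_filter; exact: cvg_id. Qed.

Lemma powRX (R : realType) (x s : R) n : 0 <= x -> (x ^+ n) `^ s = (x `^ s) ^+ n.
Proof. by move=> x0; rewrite -(powR_mulrn n x0) powRAC powR_mulrn // powR_ge0. Qed.

(** For dl > 0 and a small e, the sum of the lattice points of the two bodies and
    of {0,1}^d lies in (1 + dl) times the sum of the bodies. With the weights
    s = p/(p+q) and t = q/(p+q) the lattice inequality becomes
    ((1 - dl)(p + q))^d <= (1 + dl)^d vol, and dl tends to 0. *)
Lemma brunn_minkowski (R : realType) d (K : set 'rV[R]_d) (a b a' b' p q : R) :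
  (0 < d)%N -> fat K -> 0 <= a -> 0 <= b -> 0 < a + b -> 0 <= a' -> 0 <= b' ->
  0 < a' + b' -> 0 < p -> 0 < q ->
  p ^+ d <= vol (mink a b K) -> q ^+ d <= vol (mink a' b' K) ->
  (p + q) ^+ d <= vol (mink (a + a') (b + b') K).
Proof.
move=> d0 fK a0 b0 ab a'0 b'0 ab' p0 q0 pV qV.
have f1 := mink_fat fK a0 b0 ab.
have f2 := mink_fat fK a'0 b'0 ab'.
set S1 := mink a b K in pV f1; set S2 := mink a' b' K in qV f2.
have f3 : fat (mink (a + a') (b + b') K) by apply: mink_fat; rewrite ?addr_ge0 // addrACA addr_gt0.
set S3 := mink _ _ _ in f3 *.
have pq0 : 0 < p + q by rewrite addr_gt0.
have V0 := vol_gt0 f3.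
have main dl : 0 < dl < 1 -> ((1 - dl) * (p + q)) ^+ d <= (1 + dl) ^+ d * vol S3.
  move=> /andP[dl0 dl1].
  have dl0' : 0 < 1 + dl by rewrite addr_gt0.
  have ddl : 0 < 1 - dl by rewrite subr_gt0.
  have fd : fat (dil (1 + dl) S3).
    by rewrite dil_mink //; apply: mink_fat => //; rewrite ?mulr_ge0 ?addr_ge0 ?(ltW dl0) //
      -mulrDr mulr_gt0 // addrACA addr_gt0.
  rewrite -(vol_dil dl0' f3).
  apply: (@ler_cvg_to _ _ _ R (fun=> _) _ _ _ (@cvg_cst _ _ _ _ _) (vol_cvg fd)).
  (* a density eventually exceeds every number below the volume *)
  have shrink (x : R) (S : set 'rV[R]_d) : 0 < x -> x ^+ d <= vol S -> fat S ->
      \forall e \near 0^'+, ((1 - dl) * x) ^+ d <= density S e.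
    move=> x0 xV fS; apply: (cvgr_ge _ (vol_cvg fS)); apply: lt_le_trans xV.
    by rewrite ltrXn2r -?lt0n ?mulr_ge0 ?ltW // gtr_pMl // ltrBlDr ltrDl.
  have N1 := shrink p S1 p0 pV f1; have N2 := shrink q S2 q0 qV f2.
  have [cS [r r0 rS] [M SM]] := f3.
  near=> e.
  have e0 : 0 < e by near: e; apply: nbhs_right_gt.
  have h1 : ((1 - dl) * p) ^+ d <= density S1 e by near: e; exact: N1.
  have h2 : ((1 - dl) * q) ^+ d <= density S2 e by near: e; exact: N2.
  have er : e <= dl * r by near: e; apply: nbhs_right_le; rewrite mulr_gt0.
  have [_ _ [M1 S1M]] := f1; have [_ _ [M2 S2M]] := f2; have [_ _ [M3 S3M]] := fd.
  set s := p / (p + q); set t := q / (p + q).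
  have s0 : 0 < s by rewrite divr_gt0.
  have t0 : 0 < t by rewrite divr_gt0.
  have st : s + t = 1 by rewrite -mulrDl divff ?gt_eqF.
  have E1 : s * (p + q) = p by rewrite /s divfK // gt_eqF.
  have E2 : t * (p + q) = q by rewrite /t divfK // gt_eqF.
  clearbody s t.
  have sub x y (z : 'rV[int]_d) : x \in pts e S1 -> y \in pts e S2 ->
      (forall i j, (z i j == 0) || (z i j == 1)) -> x + y + z \in pts e (dil (1 + dl) S3).
    move=> /(mem_pts x e0 S1M) xS /(mem_pts y e0 S2M) yS zb; apply/(mem_pts _ e0 S3M).
    rewrite !latD; set w := _ + lat e y.
    have wS : S3 w by apply: minkD => //; case: fK.
    have zq : box e (lat e z).
      by move=> j; rewrite latE; case/orP: (zb 0 j) => /eqP ->;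
        rewrite ?mulr0 ?normr0 ?mulr1 ?gtr0_norm // ltW.
    clearbody w; move: (lat e z) zq => f zq.
    rewrite /dil /=.
    have -> : (1 + dl)^-1 *: (w + f) = (1 + dl)^-1 *: w + (dl / (1 + dl)) *: (dl^-1 *: f).
      by rewrite scalerDr scalerA mulrAC divff ?gt_eqF // mul1r.
    apply: cS => //.
    - apply: rS => j; rewrite mxE normrM gtr0_norm ?invr_gt0 // ler_pdivrMl //.
      exact: le_trans (zq j) er.
    - by rewrite invr_ge0 ltW.
    - by rewrite divr_ge0 // ltW.
    - by rewrite -[X in X + _]mul1r -mulrDl divff // gt_eqF.
  have E0 : 0 < e ^+ d by rewrite exprn_gt0.
  have := brunn_minkowski_lattice s0 t0 st (pts_uniq _ _) (pts_uniq _ _) sub.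
  rewrite -(ler_pM2l E0) => h3.
  have ss0 : 0 < (s `^ s * t `^ t) ^+ d by rewrite exprn_gt0 // mulr_gt0 // powR_gt0.
  rewrite -(ler_pM2l ss0).
  apply: (@le_trans _ _ (density S1 e `^ s * density S2 e `^ t)).
    apply: (@le_trans _ _ ((((1 - dl) * p) ^+ d) `^ s * (((1 - dl) * q) ^+ d) `^ t)).
      rewrite !powRX ?mulr_ge0 ?(ltW ddl) ?(ltW p0) ?(ltW q0) // -!exprMn.
      rewrite le_eqVlt; apply/orP; left; apply/eqP.
      congr (_ ^+ _).
      have -> : s `^ s * t `^ t * ((1 - dl) * (p + q)) =
        (s `^ s * (p + q) `^ s * (1 - dl) `^ s) * (t `^ t * (p + q) `^ t * (1 - dl) `^ t).
        have U x : 0 < x -> x = x `^ s * x `^ t.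
          by move=> x0; rewrite -powRD ?st ?powRr1 ?(ltW x0) // (gt_eqF x0) implybT.
        transitivity (s `^ s * t `^ t *
          (((1 - dl) `^ s * (1 - dl) `^ t) * ((p + q) `^ s * (p + q) `^ t))).
          by rewrite -(U _ ddl) -(U _ pq0).
        move: (s `^ s) (t `^ t) ((p + q) `^ s) ((p + q) `^ t) => *.
        by move: ((1 - dl) `^ s) ((1 - dl) `^ t) => *; ring.
      rewrite -!powRM ?mulr_ge0 ?E1 ?E2 ?(ltW p0) ?(ltW q0) ?(ltW pq0)
        ?(ltW ddl) ?(ltW s0) ?(ltW t0) //.
      by rewrite !(mulrC (1 - dl)).
    by apply: ler_pM; rewrite ?powR_ge0 //; apply: ge0_ler_powR => //;
      rewrite ?nnegrE ?density_ge0 ?exprn_ge0 ?mulr_ge0 ?(ltW p0) ?(ltW q0)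
        ?(ltW ddl) ?(ltW s0) ?(ltW t0).
  rewrite /density mulrCA.
  apply: le_trans h3.
  rewrite !powRM ?ler0n ?(ltW E0) // mulrACA -powRD ?st ?powRr1 ?(ltW E0) //.
  by rewrite (gt_eqF E0) implybT.
have cv : ((1 - dl) * (p + q)) ^+ d @[dl --> (0 : R)^'+] --> ((1 - 0) * (p + q)) ^+ d.
  apply: cvg_expr; apply: (@cvgM _ _ _ _ (fun dl => 1 - dl) (fun=> _)); last exact: cvg_cst.
  by apply: (@cvgB _ _ _ _ _ (fun=> _) id); [exact: cvg_cst|exact: cvg_id_right0].
have cv' : (1 + dl) ^+ d * vol S3 @[dl --> (0 : R)^'+] --> (1 + 0) ^+ d * vol S3.
  apply: (@cvgM _ _ _ _ (fun dl => (1 + dl) ^+ d) (fun=> _)); last exact: cvg_cst.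
  apply: cvg_expr.
  by apply: (@cvgD _ _ _ _ _ (fun=> _) id); [exact: cvg_cst|exact: cvg_id_right0].
rewrite subr0 mul1r in cv; rewrite addr0 expr1n mul1r in cv'.
apply: (ler_cvg_to cv cv'); near=> dl; apply: main; apply/andP; split; near: dl.
  exact: nbhs_right_gt.
exact: nbhs_right_lt.
Unshelve. all: by end_near.
Qed.

(** * The Rogers-Shephard inequality *)

(** Choose the (a+1)-st smallest element, k, of a subset of {0, ..., n} with
    a + b + 1 elements. *)
Lemma sum_bin_conv n a b :
  (\sum_(k < n.+1) 'C(k, a) * 'C(n - k, b))%N = 'C(n.+1, (a + b).+1).
Proof.
elim: n a b => [|n IH] a b.
  by rewrite big_ord_recl big_ord0 /= addn0 !bin0n binS bin0n; case: a b => [|a] [|b].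
rewrite big_ord_recr /= subnn; case: b => [|b].
  rewrite addn0 bin0 muln1 binS -[in RHS](addn0 a) -IH addn0.
  by congr (_ + _)%N; apply: eq_bigr => k _; rewrite !bin0.
have E1 := IH a b.+1; have E2 := IH a b; rewrite addnS in E1.
rewrite muln0 addn0 addnS binS -E1 -E2 -big_split /=.
apply: eq_bigr => k _; rewrite -mulnDr subSn; last by rewrite -ltnS ltn_ord.
by rewrite binS.
Qed.

Lemma ffact_le_exp n m : (n ^_ m <= n ^ m)%N.
Proof.
elim: m => // m IH; rewrite ffactnSr expnSr; apply: leq_mul => //; exact: leq_subr.
Qed.

Lemma ffact_ge_exp n m : ((n - m) ^ m <= n ^_ m)%N.
Proof.
elim: m => // m IH; rewrite ffactnSr expnSr; apply: leq_mul; last by lia.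
by apply: leq_trans IH; case: (posnP m) => [->|m0] //; rewrite leq_exp2r //; lia.
Qed.

Lemma exp_step_ge m d : (d * m ^ d.-1 + m ^ d <= m.+1 ^ d)%N.
Proof.
elim: d => // -[_|d IH]; first by rewrite /= expn0 !expn1; lia.
move: IH; rewrite /= [(m.+1 ^ d.+2)%N]expnS [(m ^ d.+2)%N]expnS [(m ^ d.+1)%N]expnS.
move: (m ^ d)%N (m.+1 ^ d.+1)%N => X Y IH.
apply: leq_trans (leq_mul (leqnn m.+1) IH).
suff -> : (m.+1 * (d.+1 * X + m * X) = d.+2 * (m * X) + m * (m * X) + d.+1 * X)%N.
  exact: leq_addr.
by rewrite !mulSn !mulnDr (mulnCA m d); lia.
Qed.

(** A discrete Beta integral. Replacing k^d and the difference of d-th powers by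
    the falling factorials that they dominate turns the sum into the convolution
    [sum_bin_conv], whose value C(n,2d) has the right growth in n. *)
Lemma riemann_binomial n d : (0 < d)%N ->
  ((n - 2 * d) ^ (2 * d) * d`! ^ 2 <=
   (2 * d)`! * \sum_(k < n) k ^ d * ((n - k) ^ d - (n - k.+1) ^ d))%N.
Proof.
case: d => // d _; case: n => [|n]; first by rewrite sub0n exp0n ?muln_gt0 //.
apply: (@leq_trans (('C(n.+1, 2 * d.+1) * (2 * d.+1)`!) * d.+1`! ^ 2)).
  by rewrite bin_ffact leq_mul2r ffact_ge_exp orbT.
rewrite mulnAC [leqLHS]mulnC leq_mul2l; apply/orP; right.
have -> : (2 * d.+1 = (d.+1 + d).+1)%N by lia.
rewrite -sum_bin_conv big_distrl /=; apply: leq_sum => k _.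
have kn : (k <= n)%N by rewrite -ltnS ltn_ord.
rewrite subSS subSn // expnS expn1 mulnACA; apply: leq_mul.
  by rewrite bin_ffact ffact_le_exp.
rewrite factS mulnCA bin_ffact.
apply: (@leq_trans (d.+1 * (n - k) ^ d)); first by rewrite leq_mul2l ffact_le_exp.
have := exp_step_ge (n - k) d.+1; rewrite /= => h; lia.
Qed.

(** The terms count the pairs of points of P with difference z, and different z
    give different pairs. *)
Lemma size_diff_pairs d (P Z : seq 'rV[int]_d) : uniq Z ->
  (\sum_(z <- Z) count (fun x => (x - z)%R \in P) P <= size P * size P)%N.
Proof.
move=> uZ.
under eq_bigr do rewrite -sum1_count big_mkcond /=.
rewrite exchange_big /= -[X in (X * _)%N]sum1_size big_distrl /=; apply: leq_sum => x _.
rewrite mul1n -big_mkcond /= sum1_count -size_filter -(size_map (fun z => x - z)%R).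
apply: uniq_leq_size.
  by rewrite map_inj_uniq ?filter_uniq // => y z /addrI /oppr_inj.
by move=> _ /mapP[z + ->]; rewrite mem_filter => /andP[].
Qed.

(** If j is the first index at which A holds, the terms from j on telescope to at
    most c j, and the earlier ones vanish. *)
Lemma abel_levels (R : realDomainType) n (c : nat -> R) (A : nat -> bool) (f : R) :
  0 <= f -> c n = 0 -> (forall k, (k < n)%N -> c k.+1 <= c k) ->
  (forall k, (k < n)%N -> A k -> c k <= f) ->
  \sum_(k < n) (A k)%:R * (c k - c k.+1) <= f.
Proof.
move=> f0 cn cdec cf.
rewrite -(big_mkord predT (fun k => (A k)%:R * (c k - c k.+1))).
have [[j jn Aj]|no] := pselect (exists2 j, (j < n)%N & A j); last first.
  rewrite big_nat big1 // => k kn; case Ak: (A k); rewrite ?mul0r //.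
  by case: no; exists k.
have ex : exists j, (j < n)%N && A j by exists j; rewrite jn.
case: (ex_minnP ex) => m /andP[mn Am] mP.
apply: le_trans (cf m mn Am).
have -> : \sum_(0 <= k < n) (A k)%:R * (c k - c k.+1) =
    \sum_(0 <= k < m) (A k)%:R * (c k - c k.+1) + \sum_(m <= k < n) (A k)%:R * (c k - c k.+1).
  by apply: big_cat_nat => //; apply: ltnW.
rewrite [X in X + _]big_nat big1 ?add0r; last first.
  move=> k /andP[_ km]; case Ak: (A k); rewrite ?mul0r //.
  by have := mP k; rewrite Ak (ltn_trans km mn) /= => /(_ isT); rewrite leqNgt km.
apply: (@le_trans _ _ (\sum_(m <= k < n) (c k - c k.+1))).
  rewrite !big_nat; apply: ler_sum => k /andP[_ kn].
  by case: (A k); rewrite ?mul1r ?mul0r // subr_ge0 cdec.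
have : \sum_(m <= k < n) (c k.+1 - c k) = c n - c m by rewrite telescope_sumr // ltnW.
rewrite cn sub0r => h; rewrite -lerN2 -h -sumrN le_eqVlt; apply/orP; left; apply/eqP.
by apply: eq_bigr => k _; rewrite opprB.
Qed.

Lemma cvg_sum_ord (R : realType) (T : Type) (F : set_system T) (FF : Filter F) n
    (f : 'I_n -> T -> R) (a : 'I_n -> R) :
  (forall k, f k x @[x --> F] --> a k) ->
  \sum_(k < n) f k x @[x --> F] --> \sum_(k < n) a k.
Proof.
elim: n f a => [|n IH] f a fa.
  by under eq_fun do rewrite big_ord0; rewrite big_ord0; exact: cvg_cst.
under eq_fun do rewrite big_ord_recr; rewrite big_ord_recr /=.
apply: (@cvgD _ _ _ _ _ (fun x => \sum_(k < n) f (widen_ord (leqnSn n) k) x)) => //.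
exact: IH.
Qed.

Section RogersShephard.
Context {R : realType} {d : nat}.
Context (K : set 'rV[R]_d) (n : nat) (dl : R).
Context (d0 : (0 < d)%N) (fK : fat K) (n0 : (0 < n)%N) (dl01 : 0 < dl < 1).

Let rt (k : nat) : R := k%:R / n%:R.

Let n0' : 0 < n%:R :> R. Proof. by rewrite ltr0n. Qed.

Let rt0 k : 0 <= rt k. Proof. by rewrite divr_ge0. Qed.

Let rtn k : (k < n)%N -> rt k < 1.
Proof. by move=> kn; rewrite ltr_pdivrMr // mul1r ltr_nat. Qed.

Let lvl (k : nat) : set 'rV[R]_d := mink (rt k) (rt k) K.

Let core (k : nat) : set 'rV[R]_d := mink (1 - rt k) 0 K.

(* The values 0 at k = 0 and at k = n are those of (k/n)^d and (1 - k/n)^d; the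
   bodies themselves degenerate to a point there. *)
Let nlvl e k : R := if (0 < k)%N then (size (pts e (lvl k)))%:R else 0.

Let ncore e k : R := if (k < n)%N then (size (pts e (dil (1 - dl) (core k))))%:R else 0.

Let fat_core k : (k < n)%N -> fat (core k).
Proof. move=> kn; have h : 0 < 1 - rt k by rewrite subr_gt0 rtn.
by apply: mink_fat; rewrite ?addr0 ?(ltW h). Qed.

Let fat_lvl k : (0 < k)%N -> fat (lvl k).
Proof.
move=> k0; have rk : 0 < rt k by rewrite divr_gt0 ?ltr0n.
by apply: mink_fat; rewrite ?rt0 ?addr_gt0.
Qed.

(** If z = (k/n)(u - v) with u and v in K and 0 < k < n, then K and z + K both contain
    (k/n)u + (1 - k/n)K. So z is the difference of at least [ncore e k] pairs of
    lattice points of K, and there are N^2 pairs in all, where N counts the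
    points of K. Summation by parts over the nested sets (k/n)(K - K) replaces
    the integral over the level sets of the gauge of K - K. *)
Lemma rogers_shephard_lattice e : 0 < e ->
  (forall (k : 'I_n) w, (size (pts e (dil (1 - dl)%R (core k))) <=
     size (pts e (trans w (core k))))%N) ->
  \sum_(k < n) nlvl e k * (ncore e k - ncore e k.+1) <=
    (size (pts e (mink 1 0 K)))%:R ^+ 2.
Proof.
move=> e0 tr.
have cK : cvx K by case: fK.
have K0 := fat0 fK.
have /andP[dl0 dl1] := dl01.
have ddl : 0 < 1 - dl by rewrite subr_gt0.
have fat10 : fat (mink 1 0 K) by apply: mink_fat; rewrite ?addr0.
have fat11 : fat (mink 1 1 K) by apply: mink_fat; rewrite ?addr_gt0.
have [_ _ [M10 M10P]] := fat10; have [_ _ [M11 M11P]] := fat11.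
set P := pts e (mink 1 0 K); set Z := pts e (mink 1 1 K).
pose f z := count (fun x => (x - z)%R \in P) P.
pose A k z := (0 < k)%N && (z \in pts e (lvl k)).
have cdec k : (k < n)%N -> ncore e k.+1 <= ncore e k.
  move=> kn; rewrite /ncore kn; case: ifP => // k1n; rewrite ler_nat.
  have [_ _ [M MP]] := fat_core kn.
  apply: (@size_pts_le _ _ _ _ _ ((1 - dl) * M) e0).
    move=> x; apply: mink_sub => //; first by rewrite subr_ge0 ltW // rtn.
    by rewrite lerD2l lerN2 ler_pM2r ?invr_gt0 // ler_nat.
  move=> x /MP xM j; have := xM j; rewrite mxE normrM gtr0_norm ?invr_gt0 //.
  by rewrite ler_pdivrMl.
apply: (@le_trans _ _ (\sum_(k < n) \sum_(z <- Z) (A k z)%:R * (ncore e k - ncore e k.+1))).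
  apply: ler_sum => k _; rewrite -mulr_suml ler_wpM2r ?subr_ge0 ?cdec //.
  rewrite /nlvl /A; case: posnP => [->|k0]; first by rewrite sumr_ge0.
  rewrite /= -natr_sum ler_nat -big_mkcond /= sum1_count -size_filter.
  apply: uniq_leq_size; first exact: pts_uniq.
  move=> z zk; rewrite mem_filter zk /=; move: zk.
  have [_ _ [M MP]] := fat_lvl k0.
  move=> /(mem_pts z e0 MP) zk; apply/(mem_pts z e0 M11P); move: zk.
  by apply: mink_sub => //; apply/ltW/rtn.
rewrite exchange_big /=.
apply: (@le_trans _ _ (\sum_(z <- Z) (f z)%:R)); last first.
  by rewrite -natr_sum -natrX ler_nat expnS expn1 size_diff_pairs // pts_uniq.
apply: ler_sum => z _; apply: (@abel_levels _ n (ncore e) (A^~ z)) => //.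
  by rewrite /ncore ltnn.
move=> k kn /andP[k0].
have [_ _ [M MP]] := fat_lvl k0.
move=> /(mem_pts z e0 MP)[u [v [Ku Kv zE]]].
rewrite /ncore kn ler_nat.
apply: (leq_trans (tr (Ordinal kn) (rt k *: u))) => /=.
rewrite /f -size_filter; apply: uniq_leq_size; first exact: pts_uniq.
have sub : trans (rt k *: u) (core k) `<=` mink 1 0 K.
  move=> x xk; have := @minkD _ _ K (rt k) 0 (1 - rt k) 0 (rt k *: u) (x - rt k *: u) cK.
  rewrite !addr0 !(addrC (rt k)) subrK (addrC (rt k *: u)) subrK; apply => //.
    by rewrite subr_ge0 ltW // rtn.
  by exists u, u; rewrite scale0r subr0.
have [_ _ [M' M'P]] := fat_core kn.
move=> x /(mem_pts x e0 (subset_trans sub M10P)) xk.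
rewrite mem_filter; apply/andP; split; last by apply/(mem_pts _ e0 M10P)/sub.
apply/(mem_pts _ e0 M10P); rewrite latD latN zE.
have -> : lat e x - (rt k *: u - rt k *: v) = rt k *: v + (lat e x - rt k *: u).
  by rewrite opprB addrCA.
have := @minkD _ _ K (rt k) 0 (1 - rt k) 0 (rt k *: v) (lat e x - rt k *: u) cK.
rewrite !addr0 (addrC (rt k) (1 - rt k)) subrK; apply => //.
  by rewrite subr_ge0 ltW // rtn.
by exists v, v; rewrite scale0r subr0.
Qed.

Lemma rogers_shephard_riemann :
  \sum_(k < n) (rt k ^+ d * vol (mink 1 1 K)) *
    (((1 - dl) * (1 - rt k)) ^+ d * vol (mink 1 0 K) -
     ((1 - dl) * (1 - rt k.+1)) ^+ d * vol (mink 1 0 K)) <= vol (mink 1 0 K) ^+ 2.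
Proof.
have /andP[dl0 dl1] := dl01.
have ddl : 0 < 1 - dl by rewrite subr_gt0.
have fat10 : fat (mink 1 0 K) by apply: mink_fat; rewrite ?addr0.
have fat11 : fat (mink 1 1 K) by apply: mink_fat; rewrite ?addr_gt0.
have lvl_cvg k : e ^+ d * nlvl e k @[e --> 0^'+] --> rt k ^+ d * vol (mink 1 1 K).
  rewrite /nlvl; case: posnP => [->|k0].
    rewrite /rt mul0r expr0n gtn_eqF // mul0r.
    by under eq_fun do rewrite mulr0; exact: cvg_cst.
  have rk : 0 < rt k by rewrite divr_gt0 ?ltr0n.
  rewrite -vol_mink_scale ?addr_gt0 // mulr1.
  exact: (vol_cvg (fat_lvl k0)).
have core_cvg k : (k <= n)%N -> e ^+ d * ncore e k @[e --> 0^'+] -->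
    ((1 - dl) * (1 - rt k)) ^+ d * vol (mink 1 0 K).
  rewrite /ncore; case: ltngtP => // [kn|->] _; last first.
    rewrite /rt divff ?gt_eqF // subrr mulr0 expr0n gtn_eqF // mul0r.
    by under eq_fun do rewrite mulr0; exact: cvg_cst.
  have ck : 0 < (1 - dl) * (1 - rt k) by rewrite mulr_gt0 // subr_gt0 rtn.
  rewrite -vol_mink_scale ?addr0 // mulr1 mulr0.
  rewrite -[X in mink _ X](mulr0 (1 - dl)) -dil_mink //.
  apply: vol_cvg; rewrite dil_mink // mulr0; apply: mink_fat => //; rewrite ?addr0 //.
  exact: ltW.
have tr (k : 'I_n) : \forall e \near 0^'+, forall w,
   (size (pts e (dil (1 - dl)%R (core k))) <= size (pts e (trans w (core k))))%N.
  by apply: size_pts_translate => //; exact: fat_core.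
apply: (@ler_cvg_to _ ((0 : R)^'+) _ R (fun e => \sum_(k < n) (e ^+ d * nlvl e k) *
    (e ^+ d * ncore e k - e ^+ d * ncore e k.+1)) (fun e => density (mink 1 0 K) e ^+ 2)).
- apply: cvg_sum_ord => k.
  apply: (@cvgM _ _ _ _ (fun e => e ^+ d * nlvl e k)
    (fun e => e ^+ d * ncore e k - e ^+ d * ncore e k.+1)); first exact: lvl_cvg.
  by apply: (@cvgB _ _ _ _ _ (fun e => e ^+ d * ncore e k)); [apply/core_cvg/ltnW|apply: core_cvg].
- by apply: cvg_expr; exact: vol_cvg.
near=> e.
have e0 : 0 < e by near: e; apply: nbhs_right_gt.
have tre : forall (k : 'I_n) w,
   (size (pts e (dil (1 - dl)%R (core k))) <= size (pts e (trans w (core k))))%N.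
  by near: e; apply: filter_forall.
have := rogers_shephard_lattice e0 tre.
have E0 : 0 < (e ^+ d) ^+ 2 by rewrite !exprn_gt0.
rewrite -(ler_pM2l E0) -exprMn; apply: le_trans.
rewrite mulr_sumr le_eqVlt; apply/orP; left; apply/eqP; apply: eq_bigr => k _.
by rewrite -mulrBr mulrACA expr2.
Unshelve. all: by end_near.
Qed.

End RogersShephard.

(** The Riemann sum tends to the Beta integral 1/C(2d,d). Choosing n with
    2d/n < dl makes its relative error at most a factor (1 - dl)^(2d). *)
Lemma rogers_shephard (R : realType) d (K : set 'rV[R]_d) : (0 < d)%N -> fat K ->
  vol (mink 1 1 K) <= 'C(2 * d, d)%:R * vol (mink 1 0 K).
Proof.
move=> d0 fK.
have V10 : 0 < vol (mink 1 0 K) by apply: vol_gt0; apply: mink_fat; rewrite ?addr0.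
have V11 : 0 < vol (mink 1 1 K) by apply: vol_gt0; apply: mink_fat; rewrite ?addr_gt0.
apply: (@le_near0 R (fun dl => (1 - dl) ^+ d * (1 - dl) ^+ (2 * d) * vol (mink 1 1 K))).
  have cv m : (1 - dl) ^+ m @[dl --> (0 : R)^'+] --> (1 : R).
    have : (1 - dl) ^+ m @[dl --> (0 : R)^'+] --> ((1 - 0) ^+ m : R).
      by apply: cvg_expr; apply: (@cvgB _ _ _ _ _ (fun=> _) id);
        [exact: cvg_cst|exact: cvg_id_right0].
    by rewrite subr0 expr1n.
  have := @cvgM _ _ _ _ _ _ _ _ (@cvgM _ _ _ _ _ _ _ _ (cv d) (cv (2 * d)%N))
    (@cvg_cst _ (vol (mink 1 1 K)) _ _ _).
  by rewrite !mul1r; apply.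
move=> dl dl01; have /andP[dl0 dl1] := dl01.
have ddl : 0 < 1 - dl by rewrite subr_gt0.
have x0 : 0 <= (2 * d)%:R / dl by rewrite divr_ge0 // ltW.
set n := Num.bound ((2 * d)%:R / dl).
have nP : (2 * d)%:R / dl < n%:R by apply: archi_boundP.
have n0 : (0 < n)%N by rewrite -(ltr_nat R); apply: le_lt_trans nP.
have n0' : 0 < n%:R :> R by rewrite ltr0n.
rewrite ltr_pdivrMr // in nP.
have dn : (2 * d <= n)%N.
  by rewrite -(ler_nat R) (le_trans (ltW nP)) // ger_pMr // ltW.
have := rogers_shephard_riemann d0 fK n0 dl01.
set S := (\sum_(k < n) k ^ d * ((n - k) ^ d - (n - k.+1) ^ d))%N.
set v10 := vol (mink 1 0 K) in V10 *; set v11 := vol (mink 1 1 K) in V11 *.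
have -> : \sum_(k < n) (k%:R / n%:R) ^+ d * v11 *
   (((1 - dl) * (1 - k%:R / n%:R)) ^+ d * v10 -
    ((1 - dl) * (1 - k.+1%:R / n%:R)) ^+ d * v10) =
   S%:R * (v11 * v10 * (1 - dl) ^+ d / n%:R ^+ (2 * d)).
  rewrite natr_sum mulr_suml; apply: eq_bigr => k _.
  have kn := ltn_ord k.
  rewrite natrM natrB; last by rewrite leq_exp2r //; lia.
  rewrite !natrX !natrB //; last exact: ltnW.
  have E m : 1 - m / n%:R = (n%:R - m) / n%:R :> R.
    by rewrite mulrBl divff // gt_eqF.
  rewrite !E !exprMn mulnC exprM !exprVn.
  have := exprn_gt0 d n0'; rewrite expr2; move: (n%:R ^+ d) => N N0.
  by move: (_ ^+ d) (_ ^+ d) (_ ^+ d) => *; field; rewrite gt_eqF.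
move=> H; clearbody v10 v11.
have {H} H : S%:R * (1 - dl) ^+ d * v11 <= n%:R ^+ (2 * d) * v10.
  have N0 : 0 < n%:R ^+ (2 * d) :> R by rewrite exprn_gt0.
  rewrite -(ler_pM2r V10); move: H; move: (n%:R ^+ (2 * d)) N0 ((1 - dl) ^+ d) (S%:R) => N N0 x s.
  rewrite [leLHS]mulrA (ler_pdivrMr _ _ N0) => H.
  apply: (le_trans (_ : _ <= s * (v11 * v10 * x))) (le_trans H _).
    by rewrite le_eqVlt; apply/orP; left; apply/eqP; ring.
  by rewrite le_eqVlt; apply/orP; left; apply/eqP; ring.
have B : (1 - dl) ^+ (2 * d) * n%:R ^+ (2 * d) <= 'C(2 * d, d)%:R * S%:R :> R.
  rewrite -exprMn; apply: (@le_trans _ _ ((n - 2 * d) ^ (2 * d))%N%:R).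
    rewrite natrX lerXn2r ?nnegrE ?ler0n ?mulr_ge0 ?(ltW ddl) // natrB //; lra.
  rewrite -natrM ler_nat.
  have f0 : (0 < d`! * d`!)%N by rewrite muln_gt0 !fact_gt0.
  rewrite -(leq_pmul2r f0); have := riemann_binomial n d0; rewrite expnS expn1 -/S.
  move=> /leq_trans; apply; apply: eq_leq.
  have := @bin_fact (2 * d) d; rewrite (_ : 2 * d - d = d)%N; last by lia.
  by move=> <-; [rewrite -!mulnA; congr (_ * _)%N; rewrite mulnA mulnC|lia].
have N0 : 0 < n%:R ^+ (2 * d) :> R by rewrite exprn_gt0.
rewrite -(ler_pM2r N0).
have h1 : (1 - dl) ^+ (2 * d) * n%:R ^+ (2 * d) * ((1 - dl) ^+ d * v11) <=
   'C(2 * d, d)%:R * S%:R * ((1 - dl) ^+ d * v11).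
  by rewrite ler_wpM2r // mulr_ge0 ?exprn_ge0 ?(ltW ddl) ?(ltW V11).
have h2 : 'C(2 * d, d)%:R * (S%:R * (1 - dl) ^+ d * v11) <=
   'C(2 * d, d)%:R * (n%:R ^+ (2 * d) * v10) by rewrite ler_wpM2l.
apply: le_trans (_ : _ <= 'C(2 * d, d)%:R * S%:R * ((1 - dl) ^+ d * v11)) _.
  by apply: le_trans h1; rewrite le_eqVlt; apply/orP; left; apply/eqP; ring.
rewrite -mulrA [S%:R * _]mulrA; apply: le_trans h2 _.
by rewrite mulrA mulrAC.
Qed.

(** * The volume of K - lK *)

(** Here p and v are the d-th roots of the volumes of K - lK and K; Brunn-Minkowski
    for (K - lK) + (1-l)(-K) = K - K gives p + (1-l) v <= C(2d,d)^(1/d) v. *)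
Lemma vol_difference_general (R : realType) d (K : set 'rV[R]_d) (l : R) :
  (0 < d)%N -> fat K -> 0 < l < 1 ->
  vol (mink 1 l K) <= ('C(2 * d, d)%:R `^ d%:R^-1 - 1 + l) ^+ d * vol (mink 1 0 K).
Proof.
move=> d0 fK /andP[l0 l1].
have ll : 0 < 1 - l by rewrite subr_gt0.
have dn0 : d%:R != 0 :> R by rewrite pnatr_eq0 -lt0n.
have root x : 0 <= x -> (x `^ d%:R^-1) ^+ d = x :> R.
  by move=> x0; rewrite -powR_mulrn ?powR_ge0 // -powRrM mulVf // powRr1.
have V10 : 0 < vol (mink 1 0 K) by apply: vol_gt0; apply: mink_fat; rewrite ?addr0.
have V1l : 0 < vol (mink 1 l K) by apply: vol_gt0; apply: mink_fat; rewrite ?addr_gt0 ?(ltW l0).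
set v := vol (mink 1 0 K) `^ d%:R^-1.
have v0 : 0 < v by rewrite powR_gt0.
have vE : v ^+ d = vol (mink 1 0 K) := root _ (ltW V10).
clearbody v.
set p := vol (mink 1 l K) `^ d%:R^-1.
have p0 : 0 < p by rewrite powR_gt0.
have pE : p ^+ d = vol (mink 1 l K) := root _ (ltW V1l).
clearbody p.
have qE : ((1 - l) * v) ^+ d = vol (mink 0 (1 - l) K).
  have h10 : 0 < (1 : R) + 0 by rewrite addr0.
  have := vol_mink_scale fK ll ler01 (lexx 0) h10; rewrite mulr1 mulr0 => h.
  rewrite exprMn vE -h; apply: (@vol_minkN _ _ K (1 - l) 0) => //.
    exact: ltW.
  by rewrite addr0.
have H : (p + (1 - l) * v) ^+ d <= vol (mink 1 1 K).
  rewrite -[X in mink X 1](addr0 1) -[X in mink _ X](subrKC l 1).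
  apply: (@brunn_minkowski R d K 1 l 0 (1 - l) p ((1 - l) * v) d0 fK ler01 (ltW l0)
    _ (lexx 0) (ltW ll) _ p0 (mulr_gt0 ll v0)).
  - by rewrite addr_gt0.
  - by rewrite add0r.
  - by rewrite pE lexx.
  - by rewrite qE lexx.
have {H} H := le_trans H (rogers_shephard d0 fK).
set C := 'C(2 * d, d)%:R `^ _.
have CE : C ^+ d = 'C(2 * d, d)%:R := root _ (ler0n _ _).
have C0 : 0 <= C by rewrite powR_ge0.
clearbody C; rewrite -CE -vE -exprMn in H; rewrite -pE -vE -exprMn.
have pv0 : 0 <= p + (1 - l) * v by rewrite addr_ge0 ?mulr_ge0 ?(ltW p0) ?(ltW v0) ?(ltW ll).
have Cv0 : 0 <= C * v by rewrite mulr_ge0 // ltW.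
move: H; rewrite ler_pXn2r ?nnegrE // => H.
have pC : p <= (C - 1 + l) * v.
  have -> : (C - 1 + l) * v = C * v - (1 - l) * v by ring.
  by rewrite lerBrDr.
by rewrite lerXn2r // nnegrE ?(ltW p0) // (le_trans (ltW p0)).
Qed.

Lemma vol_difference_symmetric (R : realType) d (K : set 'rV[R]_d) (l : R) :
  fat K -> o_symmetric K -> 0 < l ->
  vol (mink 1 l K) = (1 + l) ^+ d * vol (mink 1 0 K).
Proof.
move=> fK sK l0.
have cK : cvx K by case: fK.
have K0 := fat0 fK.
have KN u : K u -> K (- u) by move=> Ku; rewrite sK; exists u.
have h10 : 0 < (1 : R) + 0 by rewrite addr0.
have := vol_mink_scale fK (addr_gt0 ltr01 l0) ler01 (lexx 0) h10.
rewrite mulr1 mulr0 => <-; congr vol.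
apply/seteqP; split => x [u [v [Ku Kv ->]]].
  have [w Kw E] := cvx_comb cK Ku (KN _ Kv) ler01 (ltW l0).
  by exists w, w; rewrite -E scalerN scale0r subr0.
by exists u, (- u); split; [by []|exact: KN|rewrite scalerN opprK scale0r subr0 -scalerDl].
Qed.

(** * Covering by random translates *)

(** Averaging over Ts: the best element misses no more than the average does. *)
Lemma greedy_step (R : realDomainType) (T X : eqType) (Ts : seq T) (Xs : seq X)
    (M : T -> X -> bool) (q : nat) : Ts != [::] ->
  {in Xs, forall x, (q <= count (M^~ x) Ts)%N} ->
  exists t, (size Ts)%:R * (count (fun x => ~~ M t x) Xs)%:R <=
    ((size Ts)%:R - q%:R) * (size Xs)%:R :> R.
Proof.
move=> T0 qM.
pose g t : int := - (count (fun x => ~~ M t x) Xs)%:Z.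
have [t0 t0T] : exists t, t \in Ts by case: Ts T0 {qM} => // t Ts _; exists t; rewrite mem_head.
have [_ /mapP[t tT ->] tP] := @seq_max _ _ _ _ (map_f g t0T).
exists t.
apply: (@le_trans _ _ (\sum_(u <- Ts) \sum_(x <- Xs) (~~ M u x)%:R)).
  rewrite -natrM -sum1_size big_distrl natr_sum /= !big_seq; apply: ler_sum => u uT.
  rewrite mul1n -natr_sum -big_mkcond sum1_count /= ler_nat.
  by have := tP _ (map_f g uT); rewrite /g lerN2 lez_nat.
rewrite exchange_big /= -[X in _ * X%:R]sum1_size natr_sum mulr_sumr !big_seq.
apply: ler_sum => x xX; rewrite mulr1 -natr_sum -big_mkcond sum1_count /=.
have := count_predC (M^~ x) Ts; rewrite /predC => <-.
by rewrite natrD lerBrDr addrC lerD2r ler_nat qM.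
Qed.

Lemma greedy_cover (R : realFieldType) (T X : eqType) (Ts : seq T) (Xs : seq X)
    (M : T -> X -> bool) (q m : nat) : Ts != [::] -> (q <= size Ts)%N ->
  {in Xs, forall x, (q <= count (M^~ x) Ts)%N} ->
  exists2 s : seq T, size s = m & (count (fun x => ~~ has (M^~ x) s) Xs)%:R <=
    (1 - q%:R / (size Ts)%:R) ^+ m * (size Xs)%:R :> R.
Proof.
move=> T0 qT qM.
have n0 : 0 < (size Ts)%:R :> R by rewrite ltr0n lt0n size_eq0.
elim: m => [|m [s sm IH]].
  by exists [::] => //=; rewrite count_predT expr0 mul1r.
have qM' : {in [seq x <- Xs | ~~ has (M^~ x) s], forall x, (q <= count (M^~ x) Ts)%N}.
  by move=> x; rewrite mem_filter => /andP[_ /qM].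
have [t tP] := @greedy_step R _ _ Ts _ M q T0 qM'.
exists (t :: s); first by rewrite /= sm.
rewrite exprS -mulrA.
have q0 : 0 <= 1 - q%:R / (size Ts)%:R :> R.
  by rewrite subr_ge0 ler_pdivrMr // mul1r ler_nat.
apply: le_trans (ler_wpM2l q0 IH).
have E : (size Ts)%:R * (1 - q%:R / (size Ts)%:R) = (size Ts)%:R - q%:R :> R.
  by rewrite mulrBr mulr1 mulrCA divff ?gt_eqF // mulr1.
rewrite -(ler_pM2l n0) [leRHS]mulrA E -(size_filter (fun x => ~~ has (M^~ x) s)).
apply: le_trans tP; rewrite le_eqVlt; apply/orP; left; apply/eqP.
congr (_ * _%:R); rewrite count_filter; apply: eq_count => x /=.
by rewrite negb_or.
Qed.

(** The covering argument at a fixed scale e. The translation vectors are lattice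
    points of K - lK, chosen greedily so that (1-h)lK + t covers as many of the
    remaining lattice points of K - hlK as possible. If a point x of K stayed
    uncovered by the translates of lK, all lattice points of x - hlK would be
    uncovered as well, and there are at least n of these. *)
Lemma cover_lattice (R : realType) d (K : set 'rV[R]_d) (l h e : R) (m n : nat) :
  fat K -> 0 < l -> 0 < h < 1 -> 0 < e ->
  (forall w, (n <= size (pts e (trans w (mink 0 (h * l)%R K))))%N) ->
  (1 - (size (pts e (mink ((1 - h) * l) 0 K)))%:R /
       (size (pts e (mink 1 l K)))%:R) ^+ m * (size (pts e (mink 1 (h * l) K)))%:R
    < n%:R :> R ->
  exists t : 'I_m -> 'rV[R]_d,
    K `<=` \bigcup_(i in [set: 'I_m]) [set l *: x + t i | x in K].
Proof.
move=> fK l0 /andP[h0 h1] e0 tr He.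
have hh : 0 < 1 - h by rewrite subr_gt0.
have cK : cvx K by case: fK.
have K0 := fat0 fK.
have a0 : 0 < (1 - h) * l by rewrite mulr_gt0.
have b0 : 0 < h * l by rewrite mulr_gt0.
have fB : fat (mink ((1 - h) * l) 0 K) by apply: mink_fat; rewrite ?addr0 ?(ltW a0).
have fT : fat (mink 1 l K) by apply: mink_fat; rewrite ?addr_gt0 ?(ltW l0).
have fX : fat (mink 1 (h * l) K) by apply: mink_fat; rewrite ?addr_gt0 ?(ltW b0).
set S := mink 0 (h * l) K in tr.
set T := mink 1 l K in fT He *; set X := mink 1 (h * l) K in fX He *.
set B := mink ((1 - h) * l) 0 K in fB He *.
have [_ _ [MB BP]] := fB; have [_ _ [MT TP]] := fT; have [_ _ [MX XP]] := fX.
pose q := size (pts e B).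
pose M (t x : 'rV[int]_d) := (x - t) \in pts e B.
have qM : {in pts e X, forall x, (q <= count (M^~ x) (pts e T))%N}.
  move=> x /(mem_pts x e0 XP) xX.
  rewrite -size_filter /q -(size_map (fun z => x - z)); apply: uniq_leq_size.
    by rewrite map_inj_uniq ?pts_uniq // => u v /addrI /oppr_inj.
  move=> _ /mapP[z zB ->]; rewrite mem_filter /M opprB addrC subrK zB /=.
  move: zB => /(mem_pts z e0 BP) zB; apply/(mem_pts _ e0 TP).
  rewrite latD latN.
  have := minkD cK ler01 (ltW b0) (lexx 0) (ltW a0) xX (minkN zB).
  by rewrite addr0 -mulrDl subrKC mul1r.
have X0 : 0 \in pts e X.
  by apply/(mem_pts _ e0 XP); rewrite /lat map_mx0 scaler0; apply: mink0.
have T00 : pts e T != [::].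
  have : 0 \in pts e T.
    by apply/(mem_pts _ e0 TP); rewrite /lat map_mx0 scaler0; apply: mink0.
  by case: (pts e T).
have qT : (q <= size (pts e T))%N by apply: leq_trans (qM 0 X0) (count_size _ _).
have [s sm sP] := @greedy_cover R _ _ (pts e T) (pts e X) M q m T00 qT qM.
exists (fun i => lat e (nth 0 s i)) => x Kx.
apply: contrapT => nx.
have : (size (pts e (trans x S)) <= count (fun y => ~~ has (M^~ y) s) (pts e X))%N.
  rewrite -size_filter; apply: uniq_leq_size; first exact: pts_uniq.
  have SX : trans x S `<=` X.
    move=> y [u [v [_ Kv E]]]; exists x, v; split => //.
    by rewrite -[y](subrKC x) E scale0r sub0r scale1r.
  move=> y /(mem_pts y e0 (subset_trans SX XP)) yS.
  rewrite mem_filter; apply/andP; split; last by apply/(mem_pts y e0 XP)/SX.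
  apply/negP => /hasP[t ts /(mem_pts _ e0 BP)].
  rewrite latD latN => -[u [v [Ku _ E1]]].
  have [u' [v' [_ Kv' E2]]] := yS.
  have [w Kw wE] := cvx_comb cK Ku Kv' (ltW a0) (ltW b0).
  apply: nx; have it : (index t s < m)%N by rewrite -sm index_mem.
  exists (Ordinal it) => //; exists w => //=.
  rewrite nth_index //.
  have {wE} : l *: w = (1 - h) * l *: u + h * l *: v' by rewrite wE -mulrDl subrK mul1r.
  move=> ->.
  rewrite scale0r subr0 in E1; rewrite scale0r sub0r in E2.
  have -> : h * l *: v' = x - lat e y by rewrite -[h * l *: v']opprK -E2 opprB.
  by rewrite -E1 addrAC subrK subrKC.
move=> le1; have := leq_trans (tr x) le1; rewrite -(ler_nat R) => /le_trans /(_ sP).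
by apply/negP; rewrite -ltNge.
Qed.

(** The strict inequality between volumes leaves room for replacing hlK by
    (1 - dl)hlK, which is needed to count lattice points in all translates of
    hlK at once, and it then persists at a small enough scale. *)
Lemma cover_by_homothets (R : realType) d (K : set 'rV[R]_d) (l h : R) (m : nat) :
  fat K -> 0 < l -> 0 < h < 1 ->
  (1 - vol (mink ((1 - h) * l) 0 K) / vol (mink 1 l K)) ^+ m * vol (mink 1 (h * l) K)
    < vol (mink (h * l) 0 K) ->
  exists t : 'I_m -> 'rV[R]_d,
    K `<=` \bigcup_(i in [set: 'I_m]) [set l *: x + t i | x in K].
Proof.
move=> fK l0 /andP[h0 h1] H.
have hh : 0 < 1 - h by rewrite subr_gt0.
have cK : cvx K by case: fK.
have K0 := fat0 fK.
have a0 : 0 < (1 - h) * l by rewrite mulr_gt0.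
have b0 : 0 < h * l by rewrite mulr_gt0.
have fB : fat (mink ((1 - h) * l) 0 K) by apply: mink_fat; rewrite ?addr0 ?(ltW a0).
have fT : fat (mink 1 l K) by apply: mink_fat; rewrite ?addr_gt0 ?(ltW l0).
have fX : fat (mink 1 (h * l) K) by apply: mink_fat; rewrite ?addr_gt0 ?(ltW b0).
have fS : fat (mink 0 (h * l) K) by apply: mink_fat; rewrite ?add0r ?(ltW b0).
have SE : vol (mink 0 (h * l) K) = vol (mink (h * l) 0 K).
  by apply: vol_minkN => //; rewrite ?add0r // ltW.
rewrite -SE in H.
set S := mink 0 (h * l) K in fS SE H *.
set T := mink 1 l K in fT H *; set X := mink 1 (h * l) K in fX H *.
set B := mink ((1 - h) * l) 0 K in fB H *.
have [dl [dl01 Hdl]] : exists dl : R, 0 < dl < 1 /\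
   (1 - vol B / vol T) ^+ m * vol X < (1 - dl) ^+ d * vol S.
  have cv : (1 - dl) ^+ d * vol S @[dl --> (0 : R)^'+] --> (1 - 0) ^+ d * vol S.
    apply: (@cvgM _ _ _ _ (fun dl => (1 - dl) ^+ d) (fun=> vol S)); last exact: cvg_cst.
    apply: cvg_expr; apply: (@cvgB _ _ _ _ _ (fun=> _) id); last exact: cvg_id_right0.
    exact: cvg_cst.
  rewrite subr0 expr1n mul1r in cv.
  have /filter_ex[dl [dl1 dl2]] : \forall dl \near (0 : R)^'+, 0 < dl < 1 /\
      (1 - vol B / vol T) ^+ m * vol X < (1 - dl) ^+ d * vol S.
    near=> dl; split; last by near: dl; apply: (cvgr_gt _ cv).
    by apply/andP; split; near: dl; [apply: nbhs_right_gt|apply: nbhs_right_lt].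
  by exists dl; split; [exact: dl1|exact: dl2].
have ddl : 0 < 1 - dl by rewrite subr_gt0; case/andP: dl01.
have fdS : fat (dil (1 - dl) S).
  have mm : 0 < (1 - dl) * (h * l) by rewrite mulr_gt0.
  rewrite /S (@dil_mink _ _ (1 - dl) 0 (h * l) K ddl) mulr0.
  by apply: (mink_fat fK (lexx 0) (ltW mm)); rewrite add0r.
rewrite -(vol_dil ddl fS) in Hdl.
have T0 := vol_gt0 fT.
have cvT := vol_cvg fT; have cvB := vol_cvg fB; have cvX := vol_cvg fX; have cvS := vol_cvg fdS.
have /filter_ex[e [e0 tr He]] : \forall e \near (0 : R)^'+, [/\ 0 < e,
    (forall w, (size (pts e (dil (1 - dl)%R S)) <= size (pts e (trans w S)))%N) &
    (1 - density B e / density T e) ^+ m * density X e < density (dil (1 - dl) S) e].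
  have cv : density (dil (1 - dl) S) e - (1 - density B e / density T e) ^+ m * density X e
      @[e --> (0 : R)^'+] --> vol (dil (1 - dl) S) - (1 - vol B / vol T) ^+ m * vol X.
    have c1 : density B e / density T e @[e --> (0 : R)^'+] --> vol B / vol T.
      apply: (@cvgM _ _ _ _ (density B) (fun e => (density T e)^-1)); first exact: cvB.
      by apply: cvgV; [rewrite gt_eqF|exact: cvT].
    have c2 : (1 - density B e / density T e) ^+ m @[e --> (0 : R)^'+] -->
        (1 - vol B / vol T) ^+ m.
      apply: cvg_expr; apply: (@cvgB _ _ _ _ _ (fun=> _)); last exact: c1.
      exact: cvg_cst.
    apply: (@cvgB _ _ _ _ _ (density (dil (1 - dl) S))); first exact: cvS.
    by apply: (@cvgM _ _ _ _ (fun e => (1 - density B e / density T e) ^+ m));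
      [exact: c2|exact: cvX].
  have tr0 := size_pts_translate fS dl01.
  have pos : 0 < vol (dil (1 - dl) S) - (1 - vol B / vol T) ^+ m * vol X.
    by rewrite subr_gt0; exact: Hdl.
  have cv0 := cvgr_gt _ cv _ pos.
  near=> e; split.
  - by near: e; apply: nbhs_right_gt.
  - by near: e; exact: tr0.
  - by rewrite -subr_gt0; near: e; exact: cv0.
apply: (@cover_lattice R d K l h e m (size (pts e (dil (1 - dl) S))) fK l0 _ e0 tr).
  by rewrite h0 h1.
have E0 : 0 < e ^+ d by rewrite exprn_gt0.
move: He; rewrite /density -/S -/T -/X -/B.
move: (size (pts e (dil _ _)))%:R (size (pts e B))%:R (size (pts e T))%:R
  (size (pts e X))%:R (e ^+ d) E0 => nd nB nT nX E E0.
have -> : E * nB / (E * nT) = nB / nT.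
  by rewrite invfM mulrACA (divff (lt0r_neq0 E0)) mul1r.
by rewrite mulrCA (ltr_pM2l E0).
Unshelve. all: by end_near.
Qed.

(** * The choice of the shrinking parameter *)

Lemma ln_le_expR (R : realType) (x y : R) : 0 < x -> x <= expR y -> ln x <= y.
Proof. by move=> x0 xy; rewrite -[leRHS]expRK ler_ln ?posrE ?expR_gt0. Qed.

Lemma ln_ge_expR (R : realType) (x y : R) : 0 < x -> expR y <= x -> y <= ln x.
Proof. by move=> x0 xy; rewrite -[leLHS]expRK ler_ln ?posrE ?expR_gt0. Qed.

(** For d = 2, l = 2/3 and h = 1/8 the ratio b/(hl)^d is at most 6 * 12^2. As in the
    other numerical bounds, exp x >= 1 + x is used at a small x, and the power is
    reached by repeated squaring. *)
Lemma ln_6_12_12_le (R : realType) : ln (6 * 12 ^+ 2 : R) <= 36 / 5.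
Proof.
apply: ln_le_expR; first by rewrite mulr_gt0 // exprn_gt0.
have -> : 36 / 5 = 1 / 10 * 72%:R :> R by field.
have := expR_ge1Dx (1 / 10 : R); rewrite expRM_natr.
move: (expR (1 / 10)) => x x1.
have x2 : 6 / 5 <= x ^+ 2 by rewrite expr2; nra.
have x4 : 1464 / 1000 <= x ^+ 4.
  have y2 : 121 / 100 <= x ^+ 2 by rewrite expr2; nra.
  by rewrite (exprM x 2 2) [leRHS]expr2; nra.
have x8 : 2143 / 1000 <= x ^+ 8 by rewrite (exprM x 4 2) [leRHS]expr2; nra.
have x9 : 2357 / 1000 <= x ^+ 9 by rewrite exprS; nra.
have x18 : 555 / 100 <= x ^+ 18 by rewrite (exprM x 9 2) [leRHS]expr2; nra.
have x36 : 30 <= x ^+ 36 by rewrite (exprM x 18 2) [leRHS]expr2; nra.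
by rewrite (exprM x 36 2) [leRHS]expr2; nra.
Qed.

Lemma ln_2_ge (R : realType) : 2 / 3 <= ln (2 : R).
Proof.
apply: ln_ge_expR; first by rewrite ltr0n.
have := expR_ge1Dx (- (1 / 24) : R).
rewrite expRN => h.
have -> : 2 / 3 = 1 / 24 * 16%:R :> R by field.
rewrite expRM_natr; move: (expR_gt0 (1 / 24 : R)) h; move: (expR (1 / 24)) => x x0 h.
have {h} h : x <= 24 / 23.
  have : (1 - 1 / 24) * x <= x^-1 * x by rewrite ler_pM2r.
  rewrite mulVf ?gt_eqF //; lra.
have x2 : x ^+ 2 <= 1089 / 1000 by rewrite expr2; nra.
have x4 : x ^+ 4 <= 1186 / 1000 by rewrite (exprM x 2 2) [leLHS]expr2; have := exprn_gt0 2 x0; nra.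
have x8 : x ^+ 8 <= 1407 / 1000 by rewrite (exprM x 4 2) [leLHS]expr2; have := exprn_gt0 4 x0; nra.
by rewrite (exprM x 8 2) [leLHS]expr2; have := exprn_gt0 8 x0; nra.
Qed.

Lemma ln_ln_2_ge (R : realType) : - (9 / 20) <= ln (ln (2 : R)).
Proof.
apply: ln_ge_expR; first by have := ln_2_ge R; lra.
apply: le_trans (ln_2_ge R).
rewrite expRN; have -> : 9 / 20 = 3 / 20 * 3%:R :> R by field.
rewrite expRM_natr; have := expR_ge1Dx (3 / 20 : R); move: (expR (3 / 20)) => x h.
have x3 : 3 / 2 <= x ^+ 3 by rewrite !exprS expr0; nra.
by rewrite invf_ple ?posrE ?invf_div; lra.
Qed.

Lemma ln_3_ge1 (R : realType) : 1 <= ln (3 : R).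
Proof.
apply: ln_ge_expR; first by rewrite ltr0n.
have := expR_ge1Dx (- (1 / 8) : R).
rewrite expRN => h.
have -> : 1 = 1 / 8 * 8%:R :> R by field.
rewrite expRM_natr; move: (expR_gt0 (1 / 8 : R)) h; move: (expR (1 / 8)) => x x0 h.
have {h} h : x <= 8 / 7.
  have : (1 - 1 / 8) * x <= x^-1 * x by rewrite ler_pM2r.
  rewrite mulVf ?gt_eqF //; lra.
have x2 : x ^+ 2 <= 1307 / 1000 by rewrite expr2; nra.
have x4 : x ^+ 4 <= 171 / 100 by rewrite (exprM x 2 2) [leLHS]expr2; have := exprn_gt0 2 x0; nra.
by rewrite (exprM x 4 2) [leLHS]expr2; have := exprn_gt0 4 x0; nra.
Qed.

Lemma ln_64_3_le (R : realType) : ln (64 / 3 : R) <= 16 / 5.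
Proof.
apply: ln_le_expR; first by rewrite divr_gt0.
have -> : 16 / 5 = 1 / 20 * 64%:R :> R by field.
have := expR_ge1Dx (1 / 20 : R); rewrite expRM_natr.
move: (expR (1 / 20)) => x x1.
have x2 : 1102 / 1000 <= x ^+ 2 by rewrite expr2; nra.
have x4 : 1214 / 1000 <= x ^+ 4 by rewrite (exprM x 2 2) [leRHS]expr2; nra.
have x8 : 1473 / 1000 <= x ^+ 8 by rewrite (exprM x 4 2) [leRHS]expr2; nra.
have x16 : 2169 / 1000 <= x ^+ 16 by rewrite (exprM x 8 2) [leRHS]expr2; nra.
have x32 : 470 / 100 <= x ^+ 32 by rewrite (exprM x 16 2) [leRHS]expr2; nra.
by rewrite (exprM x 32 2) [leRHS]expr2; nra.
Qed.

Lemma ln_le_sub1 (R : realType) (x : R) : 0 < x -> ln x <= x - 1.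
Proof.
move=> x0; apply: ln_le_expR; first exact: x0.
by apply: le_trans (expR_ge1Dx _); rewrite subrKC.
Qed.

Lemma bernoulli_ge (R : realDomainType) (x : R) n : 0 <= x <= 1 ->
  1 - n%:R * x <= (1 - x) ^+ n.
Proof.
move=> /andP[x0 x1]; elim: n => [|n IH]; first by rewrite mul0r subr0 expr0.
have y0 : 0 <= 1 - x by rewrite subr_ge0.
rewrite exprS; apply: le_trans (ler_wpM2l y0 IH).
rewrite -natr1; have : 0 <= n%:R * (x * x) by rewrite mulr_ge0 // mulr_ge0.
by lra.
Qed.

(** The quotient is the logarithm of b/(hl)^d, where l = d/(d+1), multiplied by the
    loss (1-h)^(-d) from shrinking the homothets; the added 1 pays for rounding
    up the number of translates. For d >= 3 take h = 1/(4 d u) with u = ln d >= 1: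
    the loss is at most 4u/(4u-1) by Bernoulli's inequality, and the logarithm at
    most d (u + ln u + ln (64/3)), where 64/3 = 4 * 4 * (4/3) accounts for b, for
    the 4 in h and for (d+1)/d. For d = 2 this h is too large; h = 1/8 works. *)
Lemma choice_of_shrinking (R : realType) d (b : R) : (2 <= d)%N -> 1 <= b ->
  b <= 4 ^+ d -> (d = 2 -> b <= 6) ->
  exists h : R, [/\ 0 < h < 1,
    0 <= ln b - d%:R * ln (h * (d%:R / (d%:R + 1))) &
    (ln b - d%:R * ln (h * (d%:R / (d%:R + 1)))) / (1 - h) ^+ d + 1 <=
    d%:R * (ln d%:R + ln (ln d%:R) + 5)].
Proof.
move=> d2 b1 b4 b6.
have nonneg (h : R) : 0 < h < 1 -> 0 <= ln b - d%:R * ln (h * (d%:R / (d%:R + 1))).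
  move=> /andP[h0 h1]; rewrite subr_ge0 (@le_trans _ _ 0) ?ln_ge0 //.
  have D0 : 0 <= d%:R :> R by [].
  have D1 : 0 < d%:R + 1 :> R by lra.
  have q1 : d%:R / (d%:R + 1) <= 1 :> R by rewrite ler_pdivrMr //; lra.
  have q0 : 0 <= d%:R / (d%:R + 1) :> R by rewrite divr_ge0 // ltW.
  by rewrite mulr_ge0_le0 // ln_le0 // mulr_ile1 // ltW.
have [dE|dn2] := eqVneq d 2.
  exists (1 / 8); split; [lra|apply: nonneg; lra|].
  have {}b6 := b6 dE; rewrite dE.
  have -> : 1 / 8 * (2%:R / (2%:R + 1)) = (12 : R)^-1 by field.
  rewrite lnV ?posrE // mulrN opprK.
  have L : ln b + 2%:R * ln 12 <= 36 / 5.
    apply: le_trans (ln_6_12_12_le R).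
    have b0 : 0 < b by lra.
    have p12 : 0 < 12 ^+ 2 :> R by rewrite exprn_gt0.
    rewrite mulr_natl -lnXn // -lnM ?posrE //.
    by rewrite ler_ln ?posrE ?(mulr_gt0 b0) ?(mulr_gt0 _ p12) // ler_wpM2r // ltW.
  have := ln_2_ge R; have := ln_ln_2_ge R.
  have -> : (1 - 1 / 8) ^+ 2 = 49 / 64 :> R by field.
  rewrite invf_div; lra.
have d3 : (3 <= d)%N by case: d d2 dn2 {b4 b6 nonneg} => [|[|[|d]]].
have D3 : 3 <= d%:R :> R by rewrite ler_nat.
set D : R := d%:R in D3 *.
set u := ln D.
have u1 : 1 <= u by apply: le_trans (ln_3_ge1 R) _; rewrite ler_ln ?posrE //; lra.
have w0 : 0 <= ln u by apply: ln_ge0.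
have wu : ln u <= u - 1 by apply: ln_le_sub1; lra.
have Du : 0 < 4 * D * u by rewrite !mulr_gt0; lra.
have h01 : 0 < (4 * D * u)^-1 < 1.
  rewrite invr_gt0 Du invf_lt1 //=; nra.
exists (4 * D * u)^-1; split => //; first exact: nonneg.
have -> : (4 * D * u)^-1 * (D / (D + 1)) = (4 * u * (D + 1))^-1.
  by field; rewrite !gt_eqF //; lra.
rewrite lnV ?posrE; last by rewrite !mulr_gt0; lra.
rewrite mulrN opprK !lnM ?posrE ?mulr_gt0 //; try lra.
have lnb : ln b <= D * ln 4.
  rewrite /D mulr_natl -lnXn // ler_ln ?posrE ?exprn_gt0 //; lra.
have lnd : ln (D + 1) <= u + ln (4 / 3).
  rewrite -lnM ?posrE ?divr_gt0 //; last lra.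
  by rewrite ler_ln ?posrE ?mulr_gt0 ?divr_gt0 //; lra.
have ln64 : ln 4 + ln 4 + ln (4 / 3) <= 16 / 5 :> R.
  apply: le_trans (ln_64_3_le R).
  by rewrite -!lnM ?posrE ?mulr_gt0 ?divr_gt0 // ler_ln ?posrE ?mulr_gt0 ?divr_gt0 //; lra.
set L := ln b + _.
have LD : L <= D * (u + ln u + 16 / 5) by rewrite /L; nra.
have bern : 1 - (4 * u)^-1 <= (1 - (4 * D * u)^-1) ^+ d.
  have h01' : 0 <= (4 * D * u)^-1 <= 1 by case/andP: h01 => /ltW -> /ltW ->.
  have := @bernoulli_ge R (4 * D * u)^-1 d h01'; rewrite -/D.
  suff -> : D * (4 * D * u)^-1 = (4 * u)^-1 by [].
  by field; rewrite !gt_eqF //; lra.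
have v0 : 0 < 1 - (4 * u)^-1 by rewrite subr_gt0 invf_lt1; lra.
have M0 : 0 <= u + ln u + 16 / 5 by lra.
apply: (@le_trans _ _ (D * (u + ln u + 16 / 5) / (1 - (4 * u)^-1) + 1)).
  rewrite lerD2r; apply: (@le_trans _ _ (D * (u + ln u + 16 / 5) / (1 - (4 * D * u)^-1) ^+ d)).
    by rewrite ler_pM2r // invr_gt0; exact: lt_le_trans v0 bern.
  have DM0 : 0 <= D * (u + ln u + 16 / 5) by rewrite mulr_ge0 //; lra.
  rewrite ler_wpM2l //.
  by rewrite lef_pV2 ?posrE //; exact: lt_le_trans v0 bern.
have -> : 1 - (4 * u)^-1 = (4 * u - 1) / (4 * u) by field; rewrite gt_eqF //; lra.
have E : (u + ln u + 16 / 5) / ((4 * u - 1) / (4 * u)) <= u + ln u + 5 - 1 / 3.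
  rewrite invf_div mulrA ler_pdivrMr; last lra.
  have : 0 <= (u - 1 - ln u) by lra.
  by move: (ln u) w0 wu => w w0 wu _; nra.
rewrite -mulrA; move: E; set Q := _ / (_ / _) => E.
have : D * Q <= D * (u + ln u + 5 - 1 / 3) by rewrite ler_wpM2l //; lra.
by move: (ln u) => w; nra.
Qed.

(** * From coverings to the weak covering index *)

Lemma vol_le (R : realType) d (S T : set 'rV[R]_d) : fat S -> fat T ->
  S `<=` T -> vol S <= vol T.
Proof.
move=> fS fT ST; apply: (ler_cvg_to (vol_cvg fS) (vol_cvg fT)); near=> e.
have e0 : 0 < e by near: e; apply: nbhs_right_gt.
have [_ _ [M TM]] := fT.
by apply: ler_wpM2l; [rewrite exprn_ge0 // ltW|rewrite ler_nat; apply: size_pts_le TM].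
Unshelve. all: by end_near.
Qed.

(** The covering probability p in [cover_by_homothets] is at least
    q = (1-h)^d/G. Since 1 - p <= exp(-p), every m > ln(b/(hl)^d)/q satisfies
    the condition of that lemma; take the least such integer. *)
Lemma few_homothets (R : realType) d (K : set 'rV[R]_d) (l G b : R) :
  (2 <= d)%N -> fat K -> l = d%:R / (d%:R + 1) ->
  vol (mink 1 l K) <= G * l ^+ d * vol (mink 1 0 K) ->
  vol (mink 1 1 K) <= b * vol (mink 1 0 K) -> b <= 4 ^+ d -> (d = 2 -> b <= 6) ->
  exists m, [/\ (0 < m)%N, m%:R <= G * (d%:R * (ln d%:R + ln (ln d%:R) + 5)) &
    exists t : 'I_m -> 'rV[R]_d,
      K `<=` \bigcup_(i in [set: 'I_m]) [set l *: x + t i | x in K]].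
Proof.
move=> d2 fK lE Gl bV b4 b6.
have cK : cvx K by case: fK.
have K0 := fat0 fK.
have d0 : 0 < d%:R :> R by rewrite ltr0n; apply: leq_trans d2.
have l0 : 0 < l by rewrite lE divr_gt0 // addr_gt0.
have l1 : l < 1 by rewrite lE ltr_pdivrMr ?addr_gt0 // mul1r ltrDl.
have f10 : fat (mink 1 0 K) by apply: mink_fat; rewrite ?addr0.
have f1l : fat (mink 1 l K) by apply: mink_fat; rewrite ?addr_gt0 // ltW.
have f11 : fat (mink 1 1 K) by apply: mink_fat; rewrite ?addr_gt0.
have V10 := vol_gt0 f10; have V1l := vol_gt0 f1l.
have V10l : vol (mink 1 0 K) <= vol (mink 1 l K).
  by apply: vol_le => //; apply: mink_sub => //; exact: ltW.
have V1011 : vol (mink 1 0 K) <= vol (mink 1 1 K).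
  by apply: vol_le => //; apply: mink_sub.
have b1 : 1 <= b by rewrite -(ler_pM2r V10) mul1r; exact: le_trans V1011 bV.
have G1 : 1 <= G.
  have : 1 * vol (mink 1 0 K) <= G * l ^+ d * vol (mink 1 0 K).
    by rewrite mul1r; exact: le_trans V10l Gl.
  rewrite (ler_pM2r V10) => GL.
  have ld0 : 0 < l ^+ d by rewrite exprn_gt0.
  have ld1 : l ^+ d <= 1 by rewrite exprn_ile1 // ltW.
  have G0 : 0 <= G by rewrite -(ler_pM2r ld0) mul0r (le_trans ler01).
  by apply: (le_trans GL); rewrite ler_piMr.
have [h [h01 L0 hP]] := choice_of_shrinking d2 b1 b4 b6.
rewrite -lE in L0 hP; set L := ln b - _ in L0 hP.
have /andP[h0 h1] := h01.
have hh : 0 < 1 - h by rewrite subr_gt0.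
have hd : 0 < (1 - h) ^+ d by rewrite exprn_gt0.
have G0 : 0 < G by apply: lt_le_trans G1.
set q := (1 - h) ^+ d / G.
have q0 : 0 < q by rewrite divr_gt0.
have x0 : 0 <= L / q by rewrite divr_ge0 // ltW.
exists (Num.truncn (L / q)).+1; set m := (Num.truncn _).+1.
have mL : L / q < m%:R by apply: truncnS_gt.
split => //.
  apply: (@le_trans _ _ (L / q + 1)).
    by rewrite -natr1 lerD2r truncn_le.
  apply: (@le_trans _ _ (G * (L / (1 - h) ^+ d + 1))).
    rewrite mulrDr mulr1 lerD // /q invf_div mulrCA mulrA; last first.
    by rewrite mulrAC.
  by apply: ler_wpM2l hP; exact: ltW.
apply: (cover_by_homothets fK l0 h01).
have hl0 : 0 < h * l by rewrite mulr_gt0.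
have hhl : 0 < (1 - h) * l by rewrite mulr_gt0.
have h10 : 0 < (1 : R) + 0 by rewrite addr0.
have := vol_mink_scale fK hl0 ler01 (lexx 0) h10; rewrite mulr1 mulr0 => ->.
have E2 := vol_mink_scale fK hhl ler01 (lexx 0) h10; rewrite mulr1 mulr0 in E2.
have fB : fat (mink ((1 - h) * l) 0 K) by apply: mink_fat; rewrite ?addr0 // ltW.
have fX : fat (mink 1 (h * l) K) by apply: mink_fat; rewrite ?addr_gt0 // ltW.
have VB : vol (mink ((1 - h) * l) 0 K) <= vol (mink 1 l K).
  apply: vol_le => //; apply: mink_sub => //; [exact: ltW| |exact: ltW].
  by rewrite mulr_ile1 // ltW // gtrBl.
have VX : vol (mink 1 (h * l) K) <= b * vol (mink 1 0 K).
  apply: le_trans bV; apply: vol_le => //; apply: mink_sub => //; first exact: ltW.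
  by rewrite mulr_ile1 // ltW.
have VX0 := vol_gt0 fX.
set p := vol (mink ((1 - h) * l) 0 K) / vol (mink 1 l K).
have qp : q <= p.
  rewrite /p E2 (ler_pdivlMr _ _ V1l) exprMn.
  apply: (@le_trans _ _ (q * (G * l ^+ d * vol (mink 1 0 K)))).
    by apply: ler_wpM2l => //; exact: ltW.
  rewrite /q !mulrA divfK ?gt_eqF //.
have p1 : 0 <= 1 - p by rewrite subr_ge0 (ler_pdivrMr _ _ V1l) mul1r; exact: VB.
clearbody p.
have pe : 1 - p <= expR (- q).
  by apply: (le_trans (lerB (lexx 1) qp)); exact: expR_ge1Dx.
have pm : (1 - p) ^+ m <= expR (- q * m%:R).
  by rewrite expRM_natr; apply: lerXn2r => //; rewrite nnegrE expR_ge0.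
apply: (@le_lt_trans _ _ (expR (- q * m%:R) * (b * vol (mink 1 0 K)))).
  exact: (ler_pM (exprn_ge0 m p1) (ltW VX0) pm VX).
rewrite mulrA (ltr_pM2r V10).
have b0 : 0 < b by apply: lt_le_trans b1.
have hld : 0 < (h * l) ^+ d by rewrite exprn_gt0.
have bE : expR (ln b) = b by apply: lnK; rewrite posrE.
have hlE : expR (ln ((h * l) ^+ d)) = (h * l) ^+ d by apply: lnK; rewrite posrE.
rewrite -{1}bE -hlE -expRD ltr_expR (lnXn _ hl0) -(mulr_natl (ln (h * l))) mulNr.
by rewrite addrC ltrBlDl -ltrBlDr (mulrC q) -(ltr_pdivrMr _ _ q0); exact: mL.
Qed.

Section Translation.
Context {R : realType} {d : nat}.
Implicit Types K : set 'rV[R]_d.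

Lemma cover_translate K (w : 'rV[R]_d) (l : R) m :
  (exists t : 'I_m -> 'rV[R]_d, [set x | K (x + w)] `<=`
     \bigcup_(i in [set: 'I_m]) [set l *: x + t i | x in [set x | K (x + w)]]) ->
  exists t : 'I_m -> 'rV[R]_d,
     K `<=` \bigcup_(i in [set: 'I_m]) [set l *: x + t i | x in K].
Proof.
move=> [t tP]; exists (fun i => t i + w - l *: w) => x Kx.
have [|i _ [y Ky E]] := tP (x - w); first by rewrite /= subrK.
exists i => //; exists (y + w) => //.
by rewrite scalerDr -(subrK w x) -E addrACA subrr addr0 addrA.
Qed.

Lemma coin_w_le K (l : R) m : (0 < m)%N -> 0 < l < 1 ->
  (exists t : 'I_m -> 'rV[R]_d,
     K `<=` \bigcup_(i in [set: 'I_m]) [set l *: x + t i | x in K]) ->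
  (coin_w K <= (m%:R / (1 - l))%:E)%E.
Proof.
move=> m0 /andP[l0 l1] cover.
have gl : gamma m K <= l by apply: ge_inf; [exists 0 => x [/ltW]|split].
have g1 : gamma m K < 1 by apply: le_lt_trans gl l1.
apply: (@le_trans _ _ (m%:R / (1 - gamma m K))%:E); first by apply: ereal_inf_lbound; exists m.
rewrite lee_fin ler_pM2l ?ltr0n // lef_pV2 ?posrE ?subr_gt0 //.
by rewrite lerD2l lerN2.
Qed.

Lemma convex_cvx K : convex_set K -> cvx K.
Proof.
move=> cK x y a b Kx Ky a0 b0 ab.
have a1 : a <= 1 by lra.
have -> : b = 1 - a by lra.
exact: (set_mem (cK x y (Itv01 a0 a1) (mem_set Kx) (mem_set Ky))).
Qed.

Lemma interior_box K x : K° x -> exists2 r : R, 0 < r & forall y, box r (y - x) -> K y.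
Proof.
move=> /nbhs_ballP[e /= e0 eK]; exists (e / 2); first by rewrite divr_gt0.
move=> y yx; apply: eK; split => // i j; rewrite ord1 /ball /= distrC.
have := yx j; rewrite !mxE => /le_lt_trans; apply; lra.
Qed.

Lemma compact_box K : compact K -> exists M : R, K `<=` box M.
Proof.
move=> /compact_bounded[M [_ MP]]; exists (M + 1) => x Kx j.
have : `|x| <= M + 1 by apply: MP => //; rewrite ltrDl.
apply: le_trans; rewrite {2}/Num.norm /= mx_normrE.
exact: (le_bigmax _ (fun ij => `|x ij.1 ij.2|) (0, j)).
Qed.

Lemma convex_body_fat K w : convex_body K -> K° w -> fat [set x | K (x + w)].
Proof.
move=> [/compact_box[M MP] /convex_cvx cK _] /interior_box[r r0 rK]; split.
- move=> x y a b Kx Ky a0 b0 ab /=.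
  have -> : a *: x + b *: y + w = a *: (x + w) + b *: (y + w).
    by rewrite !scalerDr addrACA -scalerDl ab scale1r.
  exact: cK.
- by exists r => // x xr; apply: rK; rewrite addrK.
- exists (M + \sum_j `|w 0 j|) => x /MP xM j; have := xM j; rewrite !mxE => h.
  have wj : `|w 0 j| <= \sum_j `|w 0 j| by rewrite (bigD1 j) //= lerDl sumr_ge0.
  rewrite -(addrK (w 0 j) (x 0 j)).
  by rewrite (le_trans (ler_normB _ _)) // lerD.
Qed.

(** If the box of radius r around w lies in K, then so does the one around -w, and
    y is the midpoint of w + y and -w + y. *)
Lemma symmetric_body_fat K : convex_body K -> o_symmetric K -> fat K.
Proof.
move=> bK sK; have [_ /convex_cvx cK [w wK]] := bK.
have KN u : K u -> K (- u) by move=> Ku; rewrite sK; exists u.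
suff K0 : K° 0.
  have := convex_body_fat bK K0; suff -> : [set x | K (x + 0)] = K by [].
  by apply/seteqP; split => x /=; rewrite addr0.
have [r r0 rK] := interior_box wK.
apply/nbhs_ballP; exists r => //= y yr.
have yb : box r y.
  move=> j; case: yr => _ /(_ 0 j).
  by rewrite /ball /= mxE sub0r normrN => /ltW.
have h1 : K (w + y) by apply: rK; rewrite addrAC subrr add0r.
have h2 : K (- w + y).
  rewrite -[_ + y]opprK; apply: KN; rewrite opprD opprK; apply: rK.
  by rewrite addrAC subrr add0r => j; rewrite mxE normrN.
have -> : y = 2^-1 *: (w + y) + 2^-1 *: (- w + y).
  by apply/rowP => j; rewrite !mxE; field.
by apply: cK => //; lra.
Qed.

End Translation.

(** * The explicit bounds and their growth *)

(** By induction from (n+1)^2 C(2n+2,n+1) = (2n+2)(2n+1) C(2n,n). The factor 2n+1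
    saves the power sqrt(d) in the growth of the general bound. *)
Lemma central_binomial_sq n : ('C(2 * n, n) ^ 2 * (2 * n).+1 <= 16 ^ n)%N.
Proof.
elim: n => // n IH.
have H : (n.+1 ^ 2 * 'C(2 * n.+1, n.+1) = (2 * n).+2 * (2 * n).+1 * 'C(2 * n, n))%N.
  have e1 := mul_bin_diag (2 * n).+2 n; have e2 := mul_bin_diag (2 * n).+1 n.
  have e3 : 'C((2 * n).+1, n.+1) = 'C((2 * n).+1, n).
    by rewrite -[in LHS]bin_sub; [congr 'C(_, _); lia|lia].
  rewrite /= e3 in e1 e2.
  have -> : (2 * n.+1 = (2 * n).+2)%N by lia.
  by rewrite expnS expn1 -mulnA -e1 mulnCA -mulnA -e2 mulnA.
move: H IH; rewrite (expnS 16); move: 'C(_, _) 'C(_, _) (16 ^ n)%N => C C' p H IH.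
rewrite -(leq_pmul2l (_ : 0 < n.+1 ^ 4)%N); last by rewrite expn_gt0.
have -> : (n.+1 ^ 4 * (C' ^ 2 * (2 * n.+1).+1) = (n.+1 ^ 2 * C') ^ 2 * (2 * n.+1).+1)%N.
  by rewrite expnMn -expnM mulnA.
rewrite H.
have -> : (((2 * n).+2 * (2 * n).+1 * C) ^ 2 * (2 * n.+1).+1 =
  (((2 * n).+2 ^ 2 * (2 * n).+1 * (2 * n.+1).+1) * (C ^ 2 * (2 * n).+1)))%N by ring.
have -> : (n.+1 ^ 4 * (16 * p) = (16 * n.+1 ^ 4) * p)%N by ring.
apply: leq_mul IH.
have -> : (16 * n.+1 ^ 4 = (2 * n).+2 ^ 2 * (4 * n.+1 ^ 2))%N by ring.
by rewrite -mulnA leq_mul2l; apply/orP; right; nia.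
Qed.

Lemma central_binomial_le4 n : ('C(2 * n, n) <= 4 ^ n)%N.
Proof.
rewrite -(@leq_exp2r _ _ 2) //.
have -> : ((4 ^ n) ^ 2 = 16 ^ n)%N by rewrite -expnM mulnC expnM.
by apply: leq_trans (central_binomial_sq n); rewrite leq_pmulr.
Qed.

Section Bounds.
Context {R : realType}.

Lemma one_plus_half_lt d : (0 < d)%N -> (1 + (2 * d%:R)^-1) ^+ d < Num.sqrt (expR 1) :> R.
Proof.
move=> d0; have dR : 0 < d%:R :> R by rewrite ltr0n.
have q0 : 0 < (2 * d%:R)^-1 :> R by rewrite invr_gt0 mulr_gt0.
rewrite -(powR12_sqrt (expR_ge0 _)) /powR gt_eqF ?expR_gt0 // expRK mulr1.
have -> : 2^-1 = (2 * d%:R)^-1 * d%:R :> R by rewrite invfM divfK // gt_eqF.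
rewrite expRM_natr ltrXn2r -?lt0n ?d0 ?expR_gt1Dx ?(gt_eqF q0) // addr_ge0 // ltW.
Qed.

Lemma one_plus_lt_e d : (0 < d)%N -> (1 + d%:R^-1) ^+ d < expR 1 :> R.
Proof.
move=> d0; have dR : 0 < d%:R :> R by rewrite ltr0n.
have q0 : 0 < d%:R^-1 :> R by rewrite invr_gt0.
have -> : 1 = d%:R^-1 * d%:R :> R by rewrite mulVf // gt_eqF.
rewrite expRM_natr mulVf ?gt_eqF //.
rewrite ltrXn2r -?lt0n ?d0 ?expR_gt1Dx ?(gt_eqF q0) // addr_ge0 // ltW.
Qed.

Lemma logs_ge1 d : (2 <= d)%N -> 1 <= ln d%:R + ln (ln d%:R) + 5 :> R.
Proof.
move=> d2; have d2R : 2 <= d%:R :> R by rewrite ler_nat.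
have h1 : ln 2 <= ln d%:R :> R by rewrite ler_ln ?posrE //; lra.
have h2 := ln_2_ge R.
have h3 : ln (ln 2) <= ln (ln d%:R) :> R by rewrite ler_ln ?posrE //; lra.
have := ln_ln_2_ge R; lra.
Qed.

Lemma logs_le d : (3 <= d)%N -> ln d%:R + ln (ln d%:R) + 5 <= 7 * ln d%:R :> R.
Proof.
move=> d3; have d3R : 3 <= d%:R :> R by rewrite ler_nat.
have h1 : 1 <= ln d%:R :> R by apply: le_trans (ln_3_ge1 R) _; rewrite ler_ln ?posrE //; lra.
have : ln (ln d%:R) <= ln d%:R - 1 :> R by apply: ln_le_sub1; lra.
lra.
Qed.

Lemma coin_w_symmetric d (K : set 'rV[R]_d) : (2 <= d)%N -> convex_body K ->
  o_symmetric K -> (coin_w K < (symmetric_bound R d)%:E)%E.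
Proof.
move=> d2 bK sK; have fK := symmetric_body_fat bK sK.
have d0 : (0 < d)%N by apply: leq_trans d2.
have dR : 0 < d%:R :> R by rewrite ltr0n.
have d1R : 0 < d%:R + 1 :> R by rewrite addr_gt0.
set l : R := d%:R / (d%:R + 1).
have l0 : 0 < l by rewrite divr_gt0.
have l1 : l < 1 by rewrite ltr_pdivrMr // mul1r ltrDl.
have ld0 : 0 < l ^+ d by rewrite exprn_gt0.
have b4 : 2 ^+ d <= 4 ^+ d :> R by apply: lerXn2r; rewrite ?nnegrE //; lra.
have b6 : d = 2 -> 2 ^+ d <= 6 :> R by move=> ->; rewrite expr2; lra.
have Vl : vol (mink 1 l K) <= (1 + l) ^+ d / l ^+ d * l ^+ d * vol (mink 1 0 K).
  by rewrite divfK ?gt_eqF // (vol_difference_symmetric fK sK l0).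
have V1 : vol (mink 1 1 K) <= 2 ^+ d * vol (mink 1 0 K).
  by rewrite (vol_difference_symmetric fK sK ltr01) (_ : 1 + 1 = 2).
have [m [m0 mP cover]] := few_homothets d2 fK (erefl l) Vl V1 b4 b6.
clear Vl V1.
apply: (le_lt_trans (coin_w_le m0 _ cover)); first by rewrite l0 l1.
rewrite lte_fin /symmetric_bound.
have -> : 1 - l = (d%:R + 1)^-1 by rewrite /l; field; rewrite gt_eqF.
have Lg := logs_ge1 d2.
set L := ln _ + _ + _ in mP Lg *.
have L0 : 0 < d%:R * L by rewrite mulr_gt0 //; lra.
rewrite invrK; apply: (@le_lt_trans _ _ ((1 + l) ^+ d / l ^+ d * (d%:R * L) * (d%:R + 1))).
  by rewrite ler_pM2r.
have -> : (1 + l) ^+ d / l ^+ d = 2 ^+ d * (1 + (2 * d%:R)^-1) ^+ d.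
  by rewrite -exprVn -!exprMn; congr (_ ^+ _); rewrite /l; field; rewrite !gt_eqF.
have -> : 2 ^+ d * Num.sqrt (expR 1) * (d%:R + 1) * d%:R * L =
  2 ^+ d * Num.sqrt (expR 1) * (d%:R * L) * (d%:R + 1) by ring.
by rewrite ltr_pM2r // ltr_pM2r // ltr_pM2l ?exprn_gt0 // one_plus_half_lt.
Qed.

Lemma root_central_binomial_ge1 d : 1 <= 'C(2 * d, d)%:R `^ d%:R^-1 :> R.
Proof.
have C1 : 1 <= 'C(2 * d, d)%:R :> R by rewrite ler1n bin_gt0; lia.
rewrite -[leLHS](powRr0 ('C(2 * d, d)%:R)).
by rewrite ler_powR // invr_ge0.
Qed.

Lemma coin_w_general d (K : set 'rV[R]_d) : (2 <= d)%N -> convex_body K ->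
  (coin_w K < (general_bound R d)%:E)%E.
Proof.
move=> d2 bK; have [_ _ [w wK]] := bK; have fK := convex_body_fat bK wK.
set K' := [set x | K (x + w)] in fK.
have d0 : (0 < d)%N by apply: leq_trans d2.
have dR : 0 < d%:R :> R by rewrite ltr0n.
have d1R : 0 < d%:R + 1 :> R by rewrite addr_gt0.
set l : R := d%:R / (d%:R + 1).
have l0 : 0 < l by rewrite divr_gt0.
have l1 : l < 1 by rewrite ltr_pdivrMr // mul1r ltrDl.
have l01 : 0 < l < 1 by rewrite l0 l1.
have ld0 : 0 < l ^+ d by rewrite exprn_gt0.
have C1 := root_central_binomial_ge1 d.
set C := _ `^ _ in C1.
have CL : 0 < (C - 1 + l) ^+ d by rewrite exprn_gt0 //; lra.
have Vl : vol (mink 1 l K') <= (C - 1 + l) ^+ d / l ^+ d * l ^+ d * vol (mink 1 0 K').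
  by rewrite divfK ?gt_eqF //; apply: vol_difference_general.
have V1 := rogers_shephard d0 fK.
have b4 : 'C(2 * d, d)%:R <= 4 ^+ d :> R by rewrite -natrX ler_nat central_binomial_le4.
have b6 : d = 2 -> 'C(2 * d, d)%:R <= 6 :> R by move=> ->.
have [m [m0 mP cover]] := few_homothets d2 fK (erefl l) Vl V1 b4 b6.
clear Vl V1.
apply: (le_lt_trans (coin_w_le m0 l01 (cover_translate cover))).
rewrite lte_fin /general_bound -/C -/l.
have -> : 1 - l = (d%:R + 1)^-1 by rewrite /l; field; rewrite gt_eqF.
have Lg := logs_ge1 d2.
set L := ln _ + _ + _ in mP Lg *.
have L0 : 0 < d%:R * L by rewrite mulr_gt0 //; lra.
rewrite invrK; apply: (@le_lt_trans _ _ ((C - 1 + l) ^+ d / l ^+ d * (d%:R * L) * (d%:R + 1))).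
  by rewrite ler_pM2r.
have -> : (l ^+ d)^-1 = (1 + d%:R^-1) ^+ d.
  by rewrite -exprVn; congr (_ ^+ _); rewrite /l; field; rewrite !gt_eqF.
have -> : expR 1 * (d%:R + 1) * (C - 1 + l) ^+ d * d%:R * L =
  (C - 1 + l) ^+ d * expR 1 * (d%:R * L) * (d%:R + 1) by ring.
by rewrite ltr_pM2r // ltr_pM2r // ltr_pM2l // one_plus_lt_e.
Qed.

Lemma symmetric_bound_bigO : symmetric_bound R =O_\oo
  (fun d : nat => 2 ^+ d * d%:R ^+ 2 * ln d%:R).
Proof.
apply/eqO_exP; exists (14 * Num.sqrt (expR 1)); first by rewrite mulr_gt0 // sqrtr_gt0 expR_gt0.
exists 3%N => // d /= d3.
have d2 : (2 <= d)%N by apply: leq_trans d3.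
have dR : 3 <= d%:R :> R by rewrite ler_nat.
have L1 := logs_ge1 d2; have L7 := logs_le d3.
rewrite /symmetric_bound; set L := ln _ + _ + _ in L1 L7 *.
have u0 : 0 <= ln d%:R :> R by apply: ln_ge0; lra.
have s0 : 0 <= Num.sqrt (expR 1) :> R by apply: sqrtr_ge0.
have p0 : 0 <= 2 ^+ d :> R by rewrite exprn_ge0.
rewrite !ger0_norm; last 2 first.
- by rewrite !mulr_ge0 // ?exprn_ge0 //; lra.
- by rewrite !mulr_ge0 //; lra.
have -> : 2 ^+ d * Num.sqrt (expR 1) * (d%:R + 1) * d%:R * L =
  (2 ^+ d * Num.sqrt (expR 1)) * (((d%:R + 1) * d%:R) * L) by ring.
have -> : 14 * Num.sqrt (expR 1) * (2 ^+ d * d%:R ^+ 2 * ln d%:R) =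
  (2 ^+ d * Num.sqrt (expR 1)) * ((2 * d%:R * d%:R) * (7 * ln d%:R)) :> R by ring.
apply: ler_wpM2l; first by rewrite mulr_ge0.
have A0 : 0 <= (d%:R + 1) * d%:R :> R by rewrite mulr_ge0; lra.
have A1 : (d%:R + 1) * d%:R <= 2 * d%:R * d%:R :> R by rewrite ler_pM2r; lra.
exact: (ler_pM A0 (le_trans ler01 L1) A1 L7).
Qed.

Lemma general_bound_bigO : general_bound R =O_\oo
  (fun d : nat => 4 ^+ d * d%:R `^ (3 / 2) * ln d%:R).
Proof.
apply/eqO_exP; exists (14 * expR 1); first by rewrite mulr_gt0 // expR_gt0.
exists 3%N => // d /= d3.
have d2 : (2 <= d)%N by apply: leq_trans d3.
have d0 : (0 < d)%N by apply: leq_trans d3.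
have dR : 3 <= d%:R :> R by rewrite ler_nat.
have L1 := logs_ge1 d2; have L7 := logs_le d3.
rewrite /general_bound; set L := ln _ + _ + _ in L1 L7 *.
have u0 : 0 <= ln d%:R :> R by apply: ln_ge0; lra.
have e0 : 0 <= expR 1 :> R by apply: expR_ge0.
have C1 := root_central_binomial_ge1 d.
have Croot : ('C(2 * d, d)%:R `^ d%:R^-1) ^+ d = 'C(2 * d, d)%:R :> R.
  by rewrite -powR_mulrn ?powR_ge0 // -powRrM mulVf ?powRr1 // gt_eqF; lra.
set C := _ `^ _ in C1 Croot *.
have q0 : 0 <= d%:R / (d%:R + 1) :> R by rewrite divr_ge0; lra.
have q1 : d%:R / (d%:R + 1) <= 1 :> R by rewrite ler_pdivrMr; lra.
set q := d%:R / _ in q0 q1 *.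
have CqC : (C - 1 + q) ^+ d <= 'C(2 * d, d)%:R.
  by rewrite -Croot; apply: lerXn2r; rewrite ?nnegrE; lra.
have Cq0 : 0 <= (C - 1 + q) ^+ d by rewrite exprn_ge0 //; lra.
set r := Num.sqrt (d%:R : R).
have r0 : 0 <= r by apply: sqrtr_ge0.
have rr : r * r = d%:R by rewrite -expr2 sqr_sqrtr.
have d32 : d%:R `^ (3 / 2) = d%:R * r.
  have -> : 3 / 2 = 1 + 2^-1 :> R by field.
  rewrite powRD; last by apply/implyP => _; rewrite gt_eqF //; lra.
  by rewrite powRr1 // powR12_sqrt.
have Cr : 'C(2 * d, d)%:R * r <= 4 ^+ d.
  rewrite -(@ler_pXn2r _ 2) // ?nnegrE ?mulr_ge0 ?exprn_ge0 // exprMn [r ^+ 2]expr2 rr.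
  have -> : (4 ^+ d) ^+ 2 = (16 ^ d)%N%:R :> R by rewrite -exprM mulnC exprM natrX -natrX.
  rewrite -natrX -natrM ler_nat.
  apply: leq_trans (central_binomial_sq d).
  by rewrite leq_mul2l; apply/orP; right; lia.
rewrite d32 !ger0_norm; last 2 first.
- by rewrite !mulr_ge0 ?exprn_ge0 //; lra.
- by rewrite !mulr_ge0 //; lra.
have -> : expR 1 * (d%:R + 1) * (C - 1 + q) ^+ d * d%:R * L =
  expR 1 * ((d%:R + 1) * ((C - 1 + q) ^+ d * d%:R) * L) by ring.
have -> : 14 * expR 1 * (4 ^+ d * (d%:R * r) * ln d%:R) =
  expR 1 * ((2 * d%:R) * (4 ^+ d * r) * (7 * ln d%:R)) :> R by ring.
apply: ler_wpM2l => //.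
have B0 : 0 <= (C - 1 + q) ^+ d * d%:R by rewrite mulr_ge0.
have A0 : 0 <= d%:R + 1 :> R by lra.
have A1 : d%:R + 1 <= 2 * d%:R :> R by lra.
suff B1 : (C - 1 + q) ^+ d * d%:R <= 4 ^+ d * r.
  exact: (ler_pM (mulr_ge0 A0 B0) (le_trans ler01 L1) (ler_pM A0 B0 A1 B1) L7).
rewrite -[X in _ * X <= _]rr mulrA; apply: ler_wpM2r => //.
by apply: le_trans Cr; apply: ler_wpM2r.
Qed.

End Bounds.

Unset Implicit Arguments.

Theorem corollary7p2 (R : realType) :
  [/\ forall (d : nat) (K : set 'rV[R]_d), (2 <= d)%N -> convex_body K ->
        (o_symmetric K -> (coin_w K < (symmetric_bound R d)%:E)%E) /\
        (~ o_symmetric K -> (coin_w K < (general_bound R d)%:E)%E),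
      symmetric_bound R =O_\oo
        (fun d : nat => 2 ^+ d * d%:R ^+ 2 * ln d%:R) &
      general_bound R =O_\oo
        (fun d : nat => 4 ^+ d * d%:R `^ (3 / 2) * ln d%:R)].
Proof.
split; [|exact: symmetric_bound_bigO|exact: general_bound_bigO].
move=> d K d2 bK; split => [sK|_]; first exact: coin_w_symmetric.
exact: coin_w_general.
Qed.
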